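(* Let $\nu>0$ and $\alpha\in[0,1)$. Then the radius of convexity of order $\alpha$, $r^c_\alpha(f_\nu)$, of the function $f_\nu(z)=\left(2^{\nu}\Gamma(\nu+1)J_{\nu}(z)\right)^{1/\nu}$ is the smallest positive root of the equation $$1+\frac{rJ_\nu''(r)}{J_\nu'(r)}+\left(\frac{1}{\nu}-1\right)\frac{rJ_\nu'(r)}{J_\nu(r)}=\alpha.$$ Moreover, $r^{c}_{\alpha}(f_{\nu})<j_{\nu,1}'<j_{\nu,1}$, where $j_{\nu,1}$ and $j_{\nu,1}'$ denote the first positive zeros of $J_{\nu}$ and $J_{\nu}'$, respectively.
   Context: $J_\nu$ is the Bessel function of the first kind, $J_{\nu}(z)=\sum_{n\geq0}\frac{(-1)^{n}}{n!\,\Gamma(n+\nu+1)}\left(\frac{z}{2}\right)^{2n+\nu}$. The function $f_\nu(z)=\left(2^{\nu}\Gamma(\nu+1)J_{\nu}(z)\right)^{1/\nu}=z-\frac{1}{4\nu(\nu+1)}z^3+\dots$ is the branch normalized by $f_\nu(0)=0$, $f_\nu'(0)=1$; that is, $f_\nu(z)=z\,\bigl(2^{\nu}\Gamma(\nu+1)z^{-\nu}J_\nu(z)\bigr)^{1/\nu}$, where the even entire function $2^{\nu}\Gamma(\nu+1)z^{-\nu}J_\nu(z)$ equals $1$ at $z=0$ and its power $1/\nu$ is the analytic branch equal to $1$ at $z=0$ (defined for $|z|<j_{\nu,1}$). For a function $f$ analytic near $0$ with $f'(0)\ne 0$, the radius of convexity of order $\alpha$ is $$r^c_\alpha(f)=\sup\left\{r\in(0,\infty)\,:\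 \operatorname{Re}\left(1+\frac{zf''(z)}{f'(z)}\right)>\alpha\ \text{ for all } |z|<r\right\}$$ (the condition includes that $1+zf''(z)/f'(z)$ is defined and analytic in $|z|<r$). *)

(* Defs.v *)
From Stdlib Require Export Reals Factorial.
From Coquelicot Require Export Coquelicot.
Open Scope R_scope.

(** Euler's integral; meaningful for [0 < x]. *)
Definition Gamma (x : R) : R :=
  RInt_gen (fun t => Rpower t (x - 1) * exp (- t))
    (at_right 0) (Rbar_locally p_infty).

(** The Bessel function on the positive half-line.  Only arguments [0 < x] are
    meaningful, since [Rpower] is a junk value at nonpositive bases. *)
Definition BesselJ (nu x : R) : R :=
  Series (fun n => (-1) ^ n / (INR (fact n) * Gamma (INR n + nu + 1))
                   * Rpower (x / 2) (2 * INR n + nu)).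

Definition CSeries (a : nat -> C) : C :=
  (Series (fun n => Re (a n)), Series (fun n => Im (a n))).

Definition Cexp (z : C) : C := (exp (Re z) * cos (Im z), exp (Re z) * sin (Im z)).

(** The even entire function 2^nu Gamma(nu+1) z^(-nu) J_nu(z): the series of
    J_nu multiplied term by term by 2^nu Gamma(nu+1) z^(-nu), so that no
    non-integral power of [z] remains.  Its value at 0 is 1. *)
Definition BesselJ_entire (nu : R) (z : C) : C :=
  CSeries (fun n =>
    (RtoC ((-1) ^ n * Gamma (nu + 1) / (INR (fact n) * Gamma (INR n + nu + 1)))
     * Cpow (z / RtoC 2) (2 * n))%C).

(** The analytic logarithm of [h] vanishing at 0, for [h 0 = 1]: the integral of
    h'/h along the segment from 0 to [z].  It is the analytic branch on every
    disc about 0 on which [h] is analytic and has no zero. *)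
Definition log_branch (h : C -> C) (z : C) : C :=
  RInt (V := C_R_CompleteNormedModule)
    (fun t : R => (z * C_derive h (RtoC t * z) / h (RtoC t * z))%C) 0 1.

(** The branch of [h] to the power [p] equal to 1 at 0, for [h 0 = 1]. *)
Definition power_branch (p : R) (h : C -> C) (z : C) : C :=
  Cexp (RtoC p * log_branch h z)%C.

Definition f_nu (nu : R) (z : C) : C :=
  (z * power_branch (1 / nu) (BesselJ_entire nu) z)%C.

Definition Cdifferentiable_on_disc (r : R) (f : C -> C) : Prop :=
  forall z : C, Cmod z < r -> ex_derive (K := C_AbsRing) (V := C_NormedModule) f z.

Definition convexity_quotient (f : C -> C) (z : C) : C :=
  (RtoC 1 + z * C_derive (C_derive f) z / C_derive f z)%C.

(** Analyticity in the open disc is complex differentiability at each of its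
    points.  The first three clauses make the quotient well defined (division
    and [C_derive] are total functions). *)
Definition convex_of_order_on_disc (alpha : R) (f : C -> C) (r : R) : Prop :=
  Cdifferentiable_on_disc r f /\
  Cdifferentiable_on_disc r (C_derive f) /\
  (forall z : C, Cmod z < r -> C_derive f z <> RtoC 0) /\
  Cdifferentiable_on_disc r (convexity_quotient f) /\
  (forall z : C, Cmod z < r -> alpha < Re (convexity_quotient f z)).

Definition radius_of_convexity (alpha : R) (f : C -> C) : Rbar :=
  Lub_Rbar (fun r => 0 < r /\ convex_of_order_on_disc alpha f r).

(** Roots are points at which both quotients are defined. *)
Definition convexity_equation (nu alpha r : R) : Prop :=
  BesselJ nu r <> 0 /\ Derive (BesselJ nu) r <> 0 /\
  1 + r * Derive_n (BesselJ nu) 2 r / Derive (BesselJ nu) r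
    + (1 / nu - 1) * (r * Derive (BesselJ nu) r / BesselJ nu r) = alpha.

Definition smallest_positive (P : R -> Prop) (x : R) : Prop :=
  0 < x /\ P x /\ forall y : R, 0 < y -> P y -> x <= y.

(* Main.v *)
(** Write [w = z^2] and [2^nu Gamma(nu+1) z^(-nu) J_nu(z) = h(w)].  Bessel's equation
    turns into the Riccati equation [w p' + (nu+1) p = 1/4 + w p^2] for [p = - h'/h],
    whose recursion shows that all Taylor coefficients of [p] are positive; no
    product expansion of [h] is needed.  On an interval [0 <= w < X] where [h > 0],
    the Taylor polynomials of [p] are subsolutions of the Riccati equation, hence
    bounded by [p]: the series converges on the disc of radius [X], and since the
    coefficients grow at least geometrically, [h] must have a positive zero.
    With [P = 2 w p / nu], whose coefficients are nonnegative too,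
    [z f'/f = 1 - P] and
    [1 + z f''/f' = 1 - P - 2 w P' / (1 - P)].
    As [|P(w)| <= P(|w|)] and [|P'(w)| <= P'(|w|)], the real part of the right-hand
    side is at least its value at [|z|], which is 1 at 0 and tends to minus infinity
    at the first zero of [1 - P], that is, of [J_nu'].  This one zero lies before the
    first zero of [J_nu] by the mean value theorem. *)

Require Import Defs.
From Stdlib Require Import Reals Lra Lia Psatz.
From Coquelicot Require Import Coquelicot.
Open Scope R_scope.

(** * The Gamma function *)

(** The usual proof takes real parts in a partial fraction expansion over the zeros of [J_nu], which
    presupposes that these are real and that [h] is a product over them. Nonnegative Taylor
    coefficients of [P] yield the needed inequalities between moduli instead. The price is that [p]
    cannot start out as [- h'/h], whose coefficients have no visible sign: it is a formal series
    given by the Riccati recursion, it converges because its partial sums stay below [- h'/h], and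
    only then is it identified with [- h'/h]. The branch of the power requires [h] to have no
    complex zero in the disc, although only the positive axis has been examined. Convergence of [p]
    settles this: a primitive of [- p] is a logarithm of [h] throughout the disc. The critical
    points on the real axis are located as zeros of [Gfun] and [Kfun], which are multiplied out so
    as to be continuous up to the end of the interval searched. Discs of radius above [r] fail
    because the estimate of real parts is an equality on the positive axis. *)

Lemma is_RInt_gen_bounded (f : R -> R) (M : R) :
  (forall t, 0 < t -> continuous f t) ->
  (forall t, 0 < t -> 0 <= f t) ->
  (forall a b, 0 < a <= b -> RInt f a b <= M) ->
  exists l, is_RInt_gen f (at_right 0) (Rbar_locally p_infty) l /\
    forall a b, 0 < a <= b -> RInt f a b <= l.
Proof.
intros Hc Hp HM.
assert (Hex : forall a b, 0 < a -> 0 < b -> ex_RInt f a b).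
{ intros a b Ha Hb; apply (ex_RInt_continuous (V := R_CompleteNormedModule)).
  intros t Ht; apply Hc. unfold Rmin in Ht; destruct (Rle_dec a b); lra. }
(* Integrals of a nonnegative function grow with the interval, so their supremum is also their
   limit. *)
destruct (completeness (fun y => exists a b, 0 < a <= b /\ y = RInt f a b)) as [l [Hub Hlub]].
{ exists M; intros y (a & b & Hab & ->); auto. }
{ exists (RInt f 1 1), 1, 1; split; [lra|reflexivity]. }
exists l; split; [|intros a b Hab; apply Hub; exists a, b; auto].
intros P [eps HP].
assert (Hnear : exists a b, 0 < a <= b /\ l - eps < RInt f a b).
{ apply Classical_Prop.NNPP; intros Hn.
  assert (l <= l - eps); [|destruct eps; simpl in *; lra].
  apply Hlub; intros y (a & b & Hab & ->).
  apply Rnot_lt_le; intros Hlt; apply Hn; exists a, b; auto. }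
destruct Hnear as (a0 & b0 & Hab0 & Hl0).
apply (Filter_prod _ _ _ (fun a => 0 < a < a0) (fun b => b0 < b)).
{ assert (Ha0 : 0 < a0) by lra. exists (mkposreal a0 Ha0); intros y Hy Hy0.
  unfold ball in Hy; simpl in Hy; unfold AbsRing_ball, abs, minus, plus, opp in Hy; simpl in Hy.
  apply Rabs_def2 in Hy; lra. }
{ exists b0; auto. }
intros a b Ha Hb; exists (RInt f a b); split.
{ apply (RInt_correct (V := R_CompleteNormedModule)), Hex; simpl; lra. }
apply HP.
assert (H1 : RInt f a b <= l) by (apply Hub; exists a, b; split; [lra|auto]).
assert (H2 : RInt f a0 b0 <= RInt f a b).
{ rewrite <- (RInt_Chasles f a a0 b) by (apply Hex; lra).
  rewrite <- (RInt_Chasles f a0 b0 b) by (apply Hex; lra).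
  unfold plus; simpl.
  assert (0 <= RInt f a a0) by (apply RInt_ge_0; [lra|apply Hex; lra|intros; apply Hp; lra]).
  assert (0 <= RInt f b0 b) by (apply RInt_ge_0; [lra|apply Hex; lra|intros; apply Hp; lra]).
  lra. }
change (Rabs (RInt f a b - l) < eps). apply Rabs_def1; lra.
Qed.

(** The constant is the maximum of [t ^ y * exp (- t / 2)], attained at [t = 2 * y]; the bound is
    [ln u <= u - 1] at [u = t / (2 * y)]. Half of the exponential decay is spent here, and the other
    half remains for integrability. *)
Lemma Rpower_le_exp_half (y t : R) : 0 < y -> 0 < t ->
  Rpower t y <= exp (y * ln (2 * y) - y) * exp (t / 2).
Proof.
intros Hy Ht; rewrite <- exp_plus; unfold Rpower.
assert (H : ln (t / (2 * y)) <= t / (2 * y) - 1).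
{ assert (Hu : 0 < t / (2 * y)) by (apply Rdiv_lt_0_compat; lra).
  pose proof (exp_ineq1_le (ln (t / (2 * y)))). rewrite exp_ln in H by auto. lra. }
rewrite ln_div in H by lra.
apply (Rmult_le_compat_l y) in H; [|lra].
replace (y * (t / (2 * y) - 1)) with (t / 2 - y) in H by (field; lra).
destruct (Rle_lt_or_eq_dec (y * ln t) (y * ln (2 * y) - y + t / 2)) as [Hl|He]; [lra| |].
- left; apply exp_increasing; auto.
- rewrite He; lra.
Qed.

Lemma continuous_Gamma_integrand (y t : R) : 0 < t ->
  continuous (fun t => Rpower t y * exp (- t)) t.
Proof.
intros Ht; apply (ex_derive_continuous (K := R_AbsRing) (V := R_NormedModule)).
unfold Rpower; auto_derive; auto.
Qed.

(** The Bessel series evaluates [Gamma] only at [n + nu + 1 > 1]. There the exponent [x - 1] is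
    positive, and the integrand is at most [K * exp (- t / 2)], whose integral over the half-line is
    [2 * K]. *)
Lemma is_RInt_gen_Gamma (x : R) : 1 < x ->
  is_RInt_gen (fun t => Rpower t (x - 1) * exp (- t)) (at_right 0) (Rbar_locally p_infty)
    (Gamma x) /\ 0 < Gamma x.
Proof.
intros Hx. set (f := fun t => Rpower t (x - 1) * exp (- t)).
set (K := exp ((x - 1) * ln (2 * (x - 1)) - (x - 1))).
assert (Hfp : forall t, 0 < f t).
{ intros t; apply Rmult_lt_0_compat; apply exp_pos. }
assert (Hex : forall a b, 0 < a <= b -> ex_RInt f a b).
{ intros a b Hab; apply (ex_RInt_continuous (V := R_CompleteNormedModule)).
  intros t Ht; apply continuous_Gamma_integrand. rewrite Rmin_left in Ht; lra. }
destruct (is_RInt_gen_bounded f (2 * K)) as (l & Hl & Hlb).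
- intros; apply continuous_Gamma_integrand; auto.
- intros; left; apply Hfp.
- intros a b Hab.
  assert (HI : is_RInt (fun t => K * exp (- t / 2)) a b
            (minus (- 2 * K * exp (- b / 2)) (- 2 * K * exp (- a / 2)))).
  { apply (is_RInt_derive (V := R_CompleteNormedModule) (fun t => - 2 * K * exp (- t / 2))).
    - intros; auto_derive; auto. unfold Rdiv; field.
    - intros; apply (ex_derive_continuous (K := R_AbsRing) (V := R_NormedModule)).
      auto_derive; auto. }
  apply Rle_trans with (RInt (fun t => K * exp (- t / 2)) a b).
  + apply RInt_le; [lra|apply Hex; auto|eexists; apply HI|].
    intros t Ht; unfold f.
    replace (exp (- t / 2)) with (exp (t / 2) * exp (- t))
      by (rewrite <- exp_plus; f_equal; field).
    rewrite <- Rmult_assoc. apply Rmult_le_compat_r; [left; apply exp_pos|].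
    apply Rpower_le_exp_half; lra.
  + rewrite (is_RInt_unique _ _ _ _ HI). unfold minus, plus, opp; simpl.
    assert (0 < K) by apply exp_pos.
    pose proof (exp_pos (- b / 2)).
    assert (exp (- a / 2) < 1) by (rewrite <- exp_0; apply exp_increasing; lra).
    nra.
- assert (HG : Gamma x = l)
    by exact (is_RInt_gen_unique (V := R_CompleteNormedModule) _ _ Hl).
  rewrite HG; split; [exact Hl|].
  apply Rlt_le_trans with (RInt f 1 2); [|apply Hlb; lra].
  apply RInt_gt_0; [lra|auto|].
  intros t Ht; apply continuous_Gamma_integrand; lra.
Qed.

Lemma Gamma_pos (x : R) : 1 < x -> 0 < Gamma x.
Proof. intros Hx; apply is_RInt_gen_Gamma, Hx. Qed.

Lemma filterlim_Gamma_boundary_0 (x : R) : 0 < x ->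
  filterlim (fun t => Rpower t x * exp (- t)) (at_right 0) (locally 0).
Proof.
intros Hx P [eps HP].
assert (Hd : 0 < Rpower eps (/ x)) by apply exp_pos.
exists (mkposreal _ Hd); intros t Ht Ht0; apply HP.
change (Rabs (t - 0) < Rpower eps (/ x)) in Ht.
change (Rabs (Rpower t x * exp (- t) - 0) < eps).
rewrite Rminus_0_r, Rabs_pos_eq in * by (try apply Rmult_le_pos; left; auto; apply exp_pos).
assert (Rpower t x < eps).
{ replace (pos eps) with (Rpower (Rpower eps (/ x)) x).
  - apply Rlt_Rpower_l; auto.
  - rewrite Rpower_mult, Rinv_l, Rpower_1 by (try apply cond_pos; lra); auto. }
assert (exp (- t) < 1) by (rewrite <- exp_0; apply exp_increasing; lra).
pose proof (exp_pos (- t)). assert (0 < Rpower t x) by apply exp_pos. nra.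
Qed.

Lemma filterlim_Gamma_boundary_p_infty (x : R) : 0 < x ->
  filterlim (fun t => Rpower t x * exp (- t)) (Rbar_locally p_infty) (locally 0).
Proof.
intros Hx P [eps HP].
set (K := exp (x * ln (2 * x) - x)).
assert (HK : 0 < K) by apply exp_pos.
(* Since [exp (t / 2) >= 1 + t / 2], the majorant [K * exp (- (t / 2))] is below [eps] once
   [t > 2 * K / eps]. *)
exists (Rmax 1 (2 * K / eps)); intros t Ht; apply HP.
assert (Ht1 : 1 < t) by (eapply Rle_lt_trans; [apply Rmax_l|apply Ht]).
assert (Ht2 : 2 * K / eps < t) by (eapply Rle_lt_trans; [apply Rmax_r|apply Ht]).
change (Rabs (Rpower t x * exp (- t) - 0) < eps).
rewrite Rminus_0_r, Rabs_pos_eq by (apply Rmult_le_pos; left; apply exp_pos).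
apply Rle_lt_trans with (K * exp (- (t / 2))).
- replace (exp (- (t / 2))) with (exp (t / 2) * exp (- t))
    by (rewrite <- exp_plus; f_equal; field).
  rewrite <- Rmult_assoc. apply Rmult_le_compat_r; [left; apply exp_pos|].
  apply Rpower_le_exp_half; lra.
- rewrite exp_Ropp. pose proof (exp_ineq1_le (t / 2)) as He.
  destruct eps as [eps Heps]; simpl in *.
  apply (Rmult_lt_reg_r (exp (t / 2))); [apply exp_pos|].
  rewrite Rmult_assoc, Rinv_l, Rmult_1_r by (apply Rgt_not_eq, exp_pos).
  apply (Rmult_lt_compat_r eps) in Ht2; auto.
  replace (2 * K / eps * eps) with (2 * K) in Ht2 by (field; lra).
  nra.
Qed.

(** Integration by parts: [F] tends to 0 at both ends, and its derivative is the difference of the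
    two integrands. *)
Lemma Gamma_succ (x : R) : 1 < x -> Gamma (x + 1) = x * Gamma x.
Proof.
intros Hx.
destruct (is_RInt_gen_Gamma x Hx) as [H1 _].
destruct (is_RInt_gen_Gamma (x + 1)) as [H2 _]; [lra|].
set (F := fun t => Rpower t x * exp (- t)).
set (dF := fun t => x * (Rpower t (x - 1) * exp (- t)) - Rpower t x * exp (- t)).
assert (HdF : forall t, 0 < t -> is_derive F t (dF t)).
{ intros t Ht; unfold F, dF, Rpower; auto_derive; auto.
  replace ((x - 1) * ln t) with (x * ln t + - ln t) by ring.
  rewrite exp_plus, (exp_Ropp (ln t)), exp_ln by auto. field; lra. }
assert (H3 := is_RInt_gen_minus _ _ _ _ (is_RInt_gen_scal _ x _ H1) H2).
replace (x + 1 - 1) with x in H3 by ring.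
assert (Hpos : forall Q : R -> Prop, (forall t, 0 < t -> Q t) ->
  filter_prod (at_right 0) (Rbar_locally p_infty)
    (fun ab : R * R => forall t, Rmin (fst ab) (snd ab) <= t <= Rmax (fst ab) (snd ab) -> Q t)).
{ intros Q HQ; apply (Filter_prod _ _ _ (fun a => 0 < a) (fun b => 0 < b)).
  - exists (mkposreal 1 Rlt_0_1); auto.
  - exists 0; auto.
  - intros a b Ha Hb t Ht; simpl in Ht; apply HQ.
    assert (0 < Rmin a b) by (apply Rmin_glb_lt; auto). lra. }
assert (H4 : is_RInt_gen (Derive F) (at_right 0) (Rbar_locally p_infty) (0 - 0)).
{ apply is_RInt_gen_Derive; try typeclasses eauto.
  - apply Hpos; intros t Ht; eexists; apply HdF; auto.
  - apply Hpos; intros t Ht; apply continuous_ext_loc with dF.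
    + exists (mkposreal t Ht); intros y Hy; symmetry; apply is_derive_unique, HdF.
      change (Rabs (y - t) < t) in Hy. apply Rabs_def2 in Hy; lra.
    + apply (ex_derive_continuous (K := R_AbsRing) (V := R_NormedModule)).
      unfold dF, Rpower; auto_derive; auto.
  - apply filterlim_Gamma_boundary_0; lra.
  - apply filterlim_Gamma_boundary_p_infty; lra. }
assert (H5 : is_RInt_gen dF (at_right 0) (Rbar_locally p_infty) (0 - 0)).
{ apply (is_RInt_gen_ext (Derive F)); auto.
  eapply filter_imp; [|apply (Hpos (fun t => Derive F t = dF t))].
  - simpl; intros ab H t Ht; apply H; lra.
  - intros t Ht; apply is_derive_unique, HdF; auto. }
apply (is_RInt_gen_unique (V := R_CompleteNormedModule)) in H3.
apply (is_RInt_gen_unique (V := R_CompleteNormedModule)) in H5.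
assert (E : x * Gamma x - Gamma (x + 1) = 0 - 0) by exact (eq_trans (eq_sym H3) H5).
lra.
Qed.

(** * The entire function h and Bessel's equation *)

Lemma CV_radius_ge (a : nat -> R) (x : R) : ex_pseries a x -> Rbar_le (Rabs x) (CV_radius a).
Proof.
intros H; apply Rbar_not_lt_le; intros Hlt.
apply (CV_disk_outside _ _ Hlt).
assert (H' : ex_series (fun n => a n * x ^ n)).
{ destruct H as [l Hl]; exists l; exact (proj1 (is_pseries_R a x l) Hl). }
apply ex_series_lim_0; auto.
Qed.

Lemma sum_f_R0_nonneg (u : nat -> R) (n : nat) :
  (forall k, 0 <= u k) -> 0 <= sum_f_R0 u n.
Proof. intros H; induction n; simpl; [auto|specialize (H (S n)); lra]. Qed.

Lemma is_derive_partial_sum (c : nat -> R) (n : nat) (w : R) :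
  is_derive (fun w => sum_f_R0 (fun k => c k * w ^ k) n) w
    (sum_f_R0 (fun k => c k * (INR k * w ^ pred k)) n).
Proof.
induction n as [|n IH].
- simpl. auto_derive; auto; ring.
- cbn [sum_f_R0]. apply (is_derive_plus (V := R_NormedModule)); [apply IH|].
  auto_derive; auto. change (match n with O => 1 | S _ => INR n + 1 end) with (INR (S n)); cbn [pred]; ring.
Qed.

(** The operator [w d/dw + kappa] is diagonal on monomials; with [kappa = nu + 1] it is the linear
    side of the Riccati equation. *)
Lemma euler_partial_sum (c : nat -> R) (kappa : R) (n : nat) (w : R) :
  w * sum_f_R0 (fun k => c k * (INR k * w ^ pred k)) n
    + kappa * sum_f_R0 (fun k => c k * w ^ k) n
  = sum_f_R0 (fun k => (INR k + kappa) * c k * w ^ k) n.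
Proof.
induction n as [|n IH].
- simpl; ring.
- cbn [sum_f_R0]. rewrite <- IH. cbn [pred]. rewrite <- (tech_pow_Rmult w n). ring.
Qed.

(** The left-hand side consists of the terms of degree at most [n] of the square; the remaining
    terms are nonnegative. *)
Lemma sum_PS_mult_le_sqr (c : nat -> R) (n : nat) (w : R) :
  (forall k, 0 <= c k) -> 0 <= w ->
  sum_f_R0 (fun k => PS_mult c c k * w ^ k) n <= sum_f_R0 (fun k => c k * w ^ k) n ^ 2.
Proof.
intros Hc Hw.
assert (Hp : forall k, 0 <= c k * w ^ k) by (intros; apply Rmult_le_pos; auto; apply pow_le; auto).
assert (E : sum_f_R0 (fun k => PS_mult c c k * w ^ k) n =
  sum_f_R0 (fun k => sum_f_R0 (fun p => (c p * w ^ p) * (c (k - p)%nat * w ^ (k - p))) k) n).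
{ apply sum_eq; intros i _; unfold PS_mult. rewrite Rmult_comm, scal_sum.
  apply sum_eq; intros j Hj.
  replace i with (j + (i - j))%nat at 2 by lia. rewrite pow_add; ring. }
rewrite E. destruct n as [|n].
- simpl; lra.
- replace (sum_f_R0 (fun k => c k * w ^ k) (S n) ^ 2)
    with (sum_f_R0 (fun k => c k * w ^ k) (S n) * sum_f_R0 (fun k => c k * w ^ k) (S n)) by ring.
  rewrite (cauchy_finite (fun k => c k * w ^ k) (fun k => c k * w ^ k)) by lia.
  match goal with |- ?A <= ?A + ?B => assert (0 <= B); [|lra] end.
  apply sum_f_R0_nonneg; intros k; apply sum_f_R0_nonneg; intros l.
  apply Rmult_le_pos; auto.
Qed.

(* At a negative minimum [c > 0] one would have [dM c <= 0]. *)
Lemma euler_inequality_nonneg (M dM : R -> R) (kappa x : R) :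
  0 < kappa -> 0 <= x ->
  (forall w, 0 <= w <= x -> is_derive M w (dM w)) ->
  (forall w, 0 <= w <= x -> 0 <= w * dM w + kappa * M w) ->
  0 <= M x.
Proof.
intros Hk Hx HM HE.
destruct (continuity_ab_min M 0 x Hx) as (c & Hc & Hcx).
{ intros w Hw; apply derivable_continuous_pt; exists (dM w).
  apply is_derive_Reals, HM; auto. }
apply Rle_trans with (M c); [|apply Hc; lra].
apply Rnot_lt_le; intros Hneg.
assert (Hd : 0 < c * dM c) by (specialize (HE c Hcx); nra).
assert (Hc0 : 0 < c) by (destruct (Rle_lt_or_eq_dec 0 c) as [|<-]; nra).
assert (Hdc : 0 < dM c) by nra.
destruct (proj1 (is_derive_Reals _ _ _) (HM c Hcx) _ Hdc) as [d Hdl].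
set (e := Rmin c d / 2).
assert (He : 0 < Rmin c d) by (apply Rmin_glb_lt; auto; apply cond_pos).
pose proof (Rmin_l c d); pose proof (Rmin_r c d).
specialize (Hdl (- e)). specialize (Hc (c + - e)).
assert (Hle : M c <= M (c + - e)) by (apply Hc; unfold e; lra).
assert (Ha : Rabs ((M (c + - e) - M c) / - e - dM c) < dM c).
{ apply Hdl; unfold e; [lra|]. rewrite Rabs_Ropp, Rabs_pos_eq; lra. }
apply Rabs_def2 in Ha.
assert (Hq : (M (c + - e) - M c) / - e * (- e) = M (c + - e) - M c) by (field; unfold e; lra).
assert (0 < e) by (unfold e; lra).
nra.
Qed.

(** The zero is the supremum of the points up to which [f] stays positive; the intermediate value
    theorem alone would give some zero, not the first. *)
Lemma first_zero (f : R -> R) (b : R) :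
  0 <= b -> (forall x, 0 <= x <= b -> continuous f x) -> 0 < f 0 -> f b <= 0 ->
  exists c, 0 < c <= b /\ f c = 0 /\ forall x, 0 <= x < c -> 0 < f x.
Proof.
intros Hb Hc H0 Hfb.
set (E := fun x => 0 <= x <= b /\ forall y, 0 <= y <= x -> 0 < f y).
destruct (completeness E) as [c [Hub Hlub]].
{ exists b; intros x [Hx _]; lra. }
{ exists 0; split; [lra|]. intros y Hy; replace y with 0 by lra; auto. }
assert (Hc0 : 0 <= c).
{ apply Hub; split; [lra|]. intros y Hy; replace y with 0 by lra; auto. }
assert (Hcb : c <= b) by (apply Hlub; intros x [Hx _]; lra).
assert (Hpos : forall x, 0 <= x < c -> 0 < f x).
{ intros x Hx. destruct (Rlt_or_le 0 (f x)) as [|Hn]; auto.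
  assert (c <= x); [|lra]. apply Hlub; intros y [Hy1 Hy2].
  apply Rnot_lt_le; intros Hlt. specialize (Hy2 x). lra. }
assert (Hfc : f c = 0).
{ destruct (Rtotal_order (f c) 0) as [Hn|[He|Hp]]; auto; exfalso.
  - assert (Hn' : 0 < - f c) by lra.
    destruct (Hc c (conj Hc0 Hcb) (fun y => y < 0)) as [d Hd].
    { exists (mkposreal _ Hn'); intros y Hy. change (Rabs (y - f c) < - f c) in Hy.
      apply Rabs_def2 in Hy; lra. }
    assert (Hcp : 0 < c) by (destruct (Rle_lt_or_eq_dec 0 c) as [|He]; auto; subst; lra).
    set (e := Rmin c d / 2).
    assert (He : 0 < Rmin c d) by (apply Rmin_glb_lt; auto; apply cond_pos).
    pose proof (Rmin_l c d); pose proof (Rmin_r c d).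
    assert (f (c - e) < 0).
    { apply Hd. change (Rabs (c - e - c) < d). apply Rabs_def1; unfold e; lra. }
    assert (0 < f (c - e)) by (apply Hpos; unfold e; lra). lra.
  - destruct (Hc c (conj Hc0 Hcb) (fun y => 0 < y)) as [d Hd].
    { exists (mkposreal _ Hp); intros y Hy. change (Rabs (y - f c) < f c) in Hy.
      apply Rabs_def2 in Hy; lra. }
    assert (Hcb' : c < b) by (destruct (Rle_lt_or_eq_dec c b) as [|He]; auto; subst; lra).
    set (e := Rmin (b - c) d / 2).
    assert (He : 0 < Rmin (b - c) d) by (apply Rmin_glb_lt; [lra|apply cond_pos]).
    pose proof (Rmin_l (b - c) d); pose proof (Rmin_r (b - c) d).
    assert (c + e <= c); [|unfold e in *; lra].
    apply Hub; split; [unfold e; lra|]. intros y Hy.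
    destruct (Rlt_or_le y c); [apply Hpos; lra|].
    apply Hd. change (Rabs (y - c) < d). apply Rabs_def1; unfold e in *; lra. }
exists c; repeat split; auto.
destruct (Rle_lt_or_eq_dec 0 c) as [|He]; auto; subst; lra.
Qed.

(** The recursion is Bessel's equation in the variable [w], read off coefficientwise. [Gamma] is
    confined to [hcoef_Gamma], where the factor [4 ^ n] converts powers of [(z / 2) ^ 2] into powers
    of [z ^ 2]. *)
Fixpoint hcoef (nu : R) (n : nat) : R :=
  match n with
  | O => 1
  | S m => - hcoef nu m / (4 * INR (S m) * (INR (S m) + nu))
  end.

Lemma hcoef_S (nu : R) (n : nat) : 0 < nu ->
  4 * INR (S n) * (INR (S n) + nu) * hcoef nu (S n) = - hcoef nu n.
Proof.
intros Hnu; cbn [hcoef]. assert (0 < INR (S n)) by (apply lt_0_INR; lia).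
field; lra.
Qed.

Lemma hcoef_neq_0 (nu : R) (n : nat) : 0 < nu -> hcoef nu n <> 0.
Proof.
intros Hnu; induction n as [|n IH]; [simpl; lra|].
intros H; pose proof (hcoef_S nu n Hnu) as E; rewrite H in E; lra.
Qed.

Lemma hcoef_Gamma (nu : R) (n : nat) : 0 < nu ->
  (-1) ^ n * Gamma (nu + 1) / (INR (fact n) * Gamma (INR n + nu + 1)) = 4 ^ n * hcoef nu n.
Proof.
intros Hnu; induction n as [|n IH].
- simpl. replace (0 + nu + 1) with (nu + 1) by ring. field.
  apply Rgt_not_eq, Gamma_pos; lra.
- assert (Hn := pos_INR n).
  assert (HG : 0 < Gamma (INR n + nu + 1)) by (apply Gamma_pos; lra).
  rewrite fact_simpl, mult_INR.
  assert (HF := INR_fact_lt_0 n).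
  replace (INR (S n) + nu + 1) with (INR n + nu + 1 + 1) by (rewrite S_INR; ring).
  rewrite (Gamma_succ (INR n + nu + 1)) by lra. cbn [hcoef].
  replace (4 ^ S n * (- hcoef nu n / (4 * INR (S n) * (INR (S n) + nu))))
    with (- (4 ^ n * hcoef nu n) / (INR (S n) * (INR (S n) + nu)))
    by (rewrite S_INR; simpl; field; lra).
  rewrite <- IH, S_INR. simpl; field; lra.
Qed.

Lemma CV_radius_hcoef (nu : R) : 0 < nu -> CV_radius (hcoef nu) = p_infty.
Proof.
intros Hnu; apply CV_radius_infinite_DAlembert.
- intros; apply hcoef_neq_0; auto.
- apply is_lim_seq_le_le with (fun _ => 0) (fun n => / INR (S n)).
  + intros n; split; [apply Rabs_pos|].
    assert (H0 := hcoef_neq_0 nu n Hnu).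
    assert (Hn : 1 <= INR (S n)) by (rewrite S_INR; pose proof (pos_INR n); lra).
    cbn [hcoef].
    replace (- hcoef nu n / (4 * INR (S n) * (INR (S n) + nu)) / hcoef nu n)
      with (- / (4 * INR (S n) * (INR (S n) + nu))) by (field; lra).
    rewrite Rabs_Ropp, Rabs_pos_eq by (left; apply Rinv_0_lt_compat; nra).
    apply Rinv_le_contravar; nra.
  + apply is_lim_seq_const.
  + apply (is_lim_seq_incr_1 (fun n => / INR n)).
    apply (is_lim_seq_inv INR p_infty); [apply is_lim_seq_INR|discriminate].
Qed.

Lemma Rbar_lt_hcoef (nu x : R) : 0 < nu -> Rbar_lt (Rabs x) (CV_radius (hcoef nu)).
Proof. intros Hnu; rewrite CV_radius_hcoef; simpl; auto. Qed.

Lemma is_derive_h (nu x : R) : 0 < nu ->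
  is_derive (PSeries (hcoef nu)) x (PSeries (PS_derive (hcoef nu)) x).
Proof. intros; apply is_derive_PSeries, Rbar_lt_hcoef; auto. Qed.

Lemma is_derive_dh (nu x : R) : 0 < nu ->
  is_derive (PSeries (PS_derive (hcoef nu))) x
    (PSeries (PS_derive (PS_derive (hcoef nu))) x).
Proof.
intros; apply is_derive_PSeries; rewrite CV_radius_derive; apply Rbar_lt_hcoef; auto.
Qed.

Lemma PSeries_hcoef_0 (nu : R) : PSeries (hcoef nu) 0 = 1.
Proof. apply PSeries_0. Qed.

Lemma bessel_ode (nu x : R) : 0 < nu ->
  x * PSeries (PS_derive (PS_derive (hcoef nu))) x
    + (nu + 1) * PSeries (PS_derive (hcoef nu)) x + PSeries (hcoef nu) x / 4 = 0.
Proof.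
intros Hnu.
assert (H0 : ex_pseries (hcoef nu) x) by (apply CV_radius_inside, Rbar_lt_hcoef; auto).
assert (H1 : ex_pseries (PS_derive (hcoef nu)) x)
  by (apply CV_radius_inside; rewrite CV_radius_derive; apply Rbar_lt_hcoef; auto).
assert (H2 : ex_pseries (PS_derive (PS_derive (hcoef nu))) x)
  by (apply CV_radius_inside; rewrite !CV_radius_derive; apply Rbar_lt_hcoef; auto).
rewrite <- PSeries_incr_1, <- PSeries_scal.
replace (PSeries (hcoef nu) x / 4) with (/ 4 * PSeries (hcoef nu) x) by field.
rewrite <- (PSeries_scal (/ 4)).
rewrite <- PSeries_plus; [rewrite <- PSeries_plus| |].
- rewrite <- (PSeries_const_0 x). apply PSeries_ext; intros [|n].
  + pose proof (hcoef_S nu 0 Hnu) as E.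
    change (0 + (nu + 1) * (INR 1 * hcoef nu 1) + / 4 * hcoef nu 0 = 0).
    replace (INR 1) with 1 in * by reflexivity. lra.
  + pose proof (hcoef_S nu (S n) Hnu) as E.
    change (INR (S n) * (INR (S (S n)) * hcoef nu (S (S n)))
      + (nu + 1) * (INR (S (S n)) * hcoef nu (S (S n))) + / 4 * hcoef nu (S n) = 0).
    rewrite (S_INR (S n)) in *. lra.
- apply ex_pseries_plus; [apply ex_pseries_incr_1|apply ex_pseries_scal; [apply Rmult_comm|]]; auto.
- apply ex_pseries_scal; [apply Rmult_comm|]; auto.
- apply ex_pseries_incr_1; auto.
- apply ex_pseries_scal; [apply Rmult_comm|]; auto.
Qed.

(** * The Riccati equation for - h'/h *)

(** Each new coefficient depends on all earlier ones through a Cauchy product, which is not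
    structural recursion. Row [n] is therefore a whole function, meaningful up to index [n], and the
    coefficients are read off the diagonal. *)
Fixpoint riccati_table (nu : R) (n : nat) : nat -> R :=
  match n with
  | O => fun _ => / (4 * (nu + 1))
  | S m => fun k =>
      if Nat.leb k m then riccati_table nu m k
      else PS_mult (riccati_table nu m) (riccati_table nu m) m / (INR (S m) + nu + 1)
  end.

(* Taylor coefficients of p = - h'/h, read off from the Riccati equation
   w p' + (nu + 1) p = 1/4 + w p^2; their positivity is visible here. *)
Definition pcoef (nu : R) (n : nat) : R := riccati_table nu n n.

Lemma riccati_table_eq (nu : R) (n k : nat) : (k <= n)%nat -> riccati_table nu n k = pcoef nu k.
Proof.
induction n as [|n IH]; intros Hk.
- replace k with O by lia; reflexivity.
- destruct (Nat.eq_dec k (S n)) as [->|Hne]; [reflexivity|].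
  cbn [riccati_table]. replace (Nat.leb k n) with true by (symmetry; apply Nat.leb_le; lia).
  apply IH; lia.
Qed.

Lemma pcoef_S (nu : R) (n : nat) : 0 < nu ->
  (INR (S n) + (nu + 1)) * pcoef nu (S n) = PS_mult (pcoef nu) (pcoef nu) n.
Proof.
intros Hnu; unfold pcoef at 1; cbn [riccati_table].
replace (Nat.leb (S n) n) with false by (symmetry; apply Nat.leb_gt; lia).
transitivity (PS_mult (riccati_table nu n) (riccati_table nu n) n).
- pose proof (pos_INR (S n)); field; lra.
- apply sum_eq; intros i Hi; rewrite !riccati_table_eq by lia; reflexivity.
Qed.

Lemma pcoef_0 (nu : R) : pcoef nu 0 = / (4 * (nu + 1)).
Proof. reflexivity. Qed.

(** With [a = pcoef nu 0] and [r = a / (nu + 2)], each of the [n + 1] products in the Cauchy sum is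
    at least [a ^ 2 * r ^ n] by induction. The ratio [r] is chosen because
    [(n + 1) / (n + nu + 2) >= 1 / (nu + 2)]. *)
Lemma pcoef_lower_bound (nu : R) (n : nat) : 0 < nu ->
  pcoef nu 0 * (pcoef nu 0 / (nu + 2)) ^ n <= pcoef nu n.
Proof.
intros Hnu. assert (Ha : 0 < pcoef nu 0) by (rewrite pcoef_0; apply Rinv_0_lt_compat; lra).
set (a := pcoef nu 0) in *.
induction n as [n IH] using (well_founded_induction Wf_nat.lt_wf).
destruct n as [|n]; [simpl; unfold a; lra|].
set (r := a / (nu + 2)) in *.
assert (Hr : 0 < r) by (apply Rdiv_lt_0_compat; lra).
assert (Hn := pos_INR n).
assert (H : INR (S n) * (a * a * r ^ n) <= PS_mult (pcoef nu) (pcoef nu) n).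
{ rewrite Rmult_comm, <- sum_cte. unfold PS_mult.
  apply sum_Rle; intros k Hk.
  replace n with (k + (n - k))%nat at 1 by lia. rewrite pow_add.
  replace (a * a * (r ^ k * r ^ (n - k))) with ((a * r ^ k) * (a * r ^ (n - k))) by ring.
  assert (0 < r ^ k) by (apply pow_lt; auto). assert (0 < r ^ (n - k)) by (apply pow_lt; auto).
  apply Rmult_le_compat; try (apply Rmult_le_pos; lra); apply IH; lia. }
rewrite <- pcoef_S, S_INR in H by auto.
assert (Hrn : 0 < r ^ n) by (apply pow_lt; auto).
apply (Rmult_le_reg_l (INR n + 1 + (nu + 1))); [lra|].
apply Rle_trans with (2 := H).
replace (a * r ^ S n) with (a * a * r ^ n / (nu + 2)) by (unfold r; simpl; field; lra).
assert (Hq : 0 < a * a * r ^ n) by (apply Rmult_lt_0_compat; nra).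
set (q := a * a * r ^ n) in *.
apply (Rmult_le_reg_r (nu + 2)); [lra|].
replace ((INR n + 1 + (nu + 1)) * (q / (nu + 2)) * (nu + 2)) with ((INR n + 1 + (nu + 1)) * q) by (field; lra).
assert (0 <= (INR n * nu + INR n) * q) by (apply Rmult_le_pos; nra). lra.
Qed.

Lemma pcoef_pos (nu : R) (n : nat) : 0 < nu -> 0 < pcoef nu n.
Proof.
intros Hnu; eapply Rlt_le_trans; [|apply pcoef_lower_bound; auto].
assert (Ha : 0 < pcoef nu 0) by (rewrite pcoef_0; apply Rinv_0_lt_compat; lra).
apply Rmult_lt_0_compat; auto. apply pow_lt, Rdiv_lt_0_compat; lra.
Qed.

(** [X] is left free instead of being the first zero, because [h_has_zero] uses the same estimates
    for an [h] supposed to have no zero. *)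
Definition h_pos_below (nu X : R) : Prop := forall w, 0 <= w < X -> 0 < PSeries (hcoef nu) w.

(** Induction on [n], without presupposing that the series converges. Under [w d/dw + (nu + 1)] the
    difference of the two sides loses its terms [1/4]; for [n > 0] what remains is at least
    [w * (p ^ 2 - S ^ 2)], where [S] is the partial sum of index [n - 1], and the induction
    hypothesis with [0 <= S] makes this nonnegative. *)
Lemma pcoef_partial_sum_le (nu X : R) (n : nat) : 0 < nu -> h_pos_below nu X ->
  forall w, 0 <= w < X ->
  sum_f_R0 (fun k => pcoef nu k * w ^ k) n <= - PSeries (PS_derive (hcoef nu)) w / PSeries (hcoef nu) w.
Proof.
intros Hnu HX.
set (h := PSeries (hcoef nu)). set (dh := PSeries (PS_derive (hcoef nu))).
set (d2h := PSeries (PS_derive (PS_derive (hcoef nu)))).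
set (c := pcoef nu). set (S n w := sum_f_R0 (fun k => c k * w ^ k) n).
assert (Hc : forall k, 0 <= c k) by (intros; left; apply pcoef_pos; auto).
induction n as [n IH] using (well_founded_induction Wf_nat.lt_wf); intros x Hx.
apply Rminus_le_0.
apply (euler_inequality_nonneg (fun w => - dh w / h w - S n w)
  (fun w => (- d2h w * h w + dh w * dh w) / h w ^ 2 - sum_f_R0 (fun k => c k * (INR k * w ^ pred k)) n)
  (nu + 1)); try lra.
- intros w Hw. assert (Hh : 0 < h w) by (apply HX; lra).
  apply (is_derive_minus (V := R_NormedModule)); [|apply is_derive_partial_sum].
  assert (H1 := is_derive_h nu w Hnu). assert (H2 := is_derive_dh nu w Hnu).
  fold h dh d2h in H1, H2.
  apply (is_derive_ext (fun w => opp (dh w / h w))).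
  { intros t; unfold opp; simpl. unfold Rdiv; ring. }
  replace ((- d2h w * h w + dh w * dh w) / h w ^ 2)
    with (opp ((d2h w * h w - dh w * dh w) / h w ^ 2)) by (unfold opp; simpl; field; lra).
  apply (is_derive_opp (V := R_NormedModule)).
  apply is_derive_div; auto; lra.
- intros w Hw. assert (Hh : 0 < h w) by (apply HX; lra).
  assert (Hode := bessel_ode nu w Hnu). fold h dh d2h in Hode.
  assert (HE := euler_partial_sum c (nu + 1) n w). fold (S n w) in HE.
  set (p := - dh w / h w) in *.
  replace (w * ((- d2h w * h w + dh w * dh w) / h w ^ 2 -
      sum_f_R0 (fun k => c k * (INR k * w ^ pred k)) n) + (nu + 1) * (p - S n w))
    with (/ 4 + w * p ^ 2 - sum_f_R0 (fun k => (INR k + (nu + 1)) * c k * w ^ k) n).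
  2:{ rewrite <- HE. unfold p.
      (* Solving Bessel's equation for [h w] turns the claim into a rational identity in the
         remaining quantities. *)
      replace (h w) with (- 4 * (w * d2h w + (nu + 1) * dh w)) in * by lra.
      field. nra. }
  destruct n as [|n].
  + simpl. unfold c. rewrite pcoef_0.
    replace ((0 + (nu + 1)) * / (4 * (nu + 1)) * 1) with (/ 4) by (field; lra).
    assert (0 <= w * (p * (p * 1))) by (apply Rmult_le_pos; nra). lra.
  + rewrite decomp_sum by lia. cbn [pred].
    assert (E : sum_f_R0 (fun i => (INR (Datatypes.S i) + (nu + 1)) * c (Datatypes.S i) * w ^ Datatypes.S i) n
      = w * sum_f_R0 (fun k => PS_mult c c k * w ^ k) n).
    { rewrite scal_sum; apply sum_eq; intros i _. unfold c. rewrite pcoef_S by auto. simpl; ring. }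
    rewrite E. assert (H1 := sum_PS_mult_le_sqr c n w Hc (proj1 Hw)). fold (S n w) in H1.
    assert (H2 : S n w <= p) by (apply IH; [lia|lra]).
    assert (H3 : 0 <= S n w).
    { apply sum_f_R0_nonneg; intros k; apply Rmult_le_pos; auto; apply pow_le; lra. }
    replace ((INR 0 + (nu + 1)) * c 0%nat * w ^ 0) with (/ 4)
      by (unfold c; rewrite pcoef_0; simpl; field; lra).
    assert (S n w ^ 2 <= p ^ 2) by nra.
    assert (w * sum_f_R0 (fun k => PS_mult c c k * w ^ k) n <= w * p ^ 2)
      by (apply Rmult_le_compat_l; lra). lra.
Qed.

(** Otherwise the partial sums of [p] at [w = / r] would be bounded, while the geometric bound makes
    each of their terms at least [pcoef nu 0]. *)
Lemma h_has_zero (nu : R) : 0 < nu -> exists w, 0 <= w /\ PSeries (hcoef nu) w <= 0.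
Proof.
intros Hnu; apply Classical_Prop.NNPP; intros Hn.
assert (Ha : 0 < pcoef nu 0) by (rewrite pcoef_0; apply Rinv_0_lt_compat; lra).
set (r := pcoef nu 0 / (nu + 2)).
assert (Hr : 0 < r) by (apply Rdiv_lt_0_compat; lra).
assert (Hir : 0 < / r) by (apply Rinv_0_lt_compat; auto).
set (B := - PSeries (PS_derive (hcoef nu)) (/ r) / PSeries (hcoef nu) (/ r)).
assert (HB : forall n, INR (S n) * pcoef nu 0 <= B).
{ intros n. eapply Rle_trans; [|apply (pcoef_partial_sum_le nu (/ r + 1) n); auto; [|lra]].
  - rewrite Rmult_comm, <- sum_cte. apply sum_Rle; intros k _.
    pose proof (pcoef_lower_bound nu k Hnu) as H; fold r in H.
    apply Rle_trans with (pcoef nu 0 * r ^ k * (/ r) ^ k).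
    + rewrite pow_inv. right; field. apply pow_nonzero; lra.
    + apply Rmult_le_compat_r; auto. apply pow_le; lra.
  - intros w Hw. apply Rnot_le_lt; intros Hle; apply Hn; exists w; split; [lra|auto]. }
destruct (INR_unbounded (B / pcoef nu 0)) as [N HN].
specialize (HB N). rewrite S_INR in HB.
apply (Rmult_lt_compat_r (pcoef nu 0)) in HN; auto.
replace (B / pcoef nu 0 * pcoef nu 0) with B in HN by (field; lra). nra.
Qed.

Lemma h_first_zero (nu : R) : 0 < nu ->
  exists X, 0 < X /\ PSeries (hcoef nu) X = 0 /\ h_pos_below nu X.
Proof.
intros Hnu. destruct (h_has_zero nu Hnu) as (b & Hb & Hhb).
destruct (first_zero (PSeries (hcoef nu)) b) as (c & Hc & Hc0 & Hcp); auto.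
- intros x _. apply (ex_derive_continuous (K := R_AbsRing) (V := R_NormedModule)).
  eexists; apply is_derive_h; auto.
- rewrite PSeries_hcoef_0; lra.
- exists c; split; [lra|split; auto].
Qed.

Lemma CV_radius_pcoef (nu X x : R) : 0 < nu -> h_pos_below nu X -> Rabs x < X ->
  Rbar_lt (Rabs x) (CV_radius (pcoef nu)).
Proof.
intros Hnu HX Hx.
(* Bounded partial sums of nonnegative terms converge at the midpoint [y]; the gap between [Rabs x]
   and [y] makes the inequality strict. *)
set (y := (Rabs x + X) / 2). assert (Hx0 := Rabs_pos x).
apply Rbar_lt_le_trans with y; [simpl; unfold y; lra|].
replace y with (Rabs y) by (apply Rabs_pos_eq; unfold y; lra).
apply CV_radius_ge.
assert (Hp : forall n, 0 <= pcoef nu n * y ^ n).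
{ intros; apply Rmult_le_pos; [left; apply pcoef_pos; auto|apply pow_le; unfold y; lra]. }
destruct (ex_finite_lim_seq_incr (fun n => sum_n (fun k => pcoef nu k * y ^ k) n)
  (- PSeries (PS_derive (hcoef nu)) y / PSeries (hcoef nu) y)) as [l Hl].
- intros n; rewrite sum_Sn; unfold plus; simpl. specialize (Hp (S n)); simpl in Hp. lra.
- intros n; rewrite sum_n_Reals. apply pcoef_partial_sum_le with X; auto; unfold y; lra.
- exists l. apply is_pseries_R. exact Hl.
Qed.

Lemma riccati_pseries (nu x : R) : 0 < nu -> Rbar_lt (Rabs x) (CV_radius (pcoef nu)) ->
  x * PSeries (PS_derive (pcoef nu)) x + (nu + 1) * PSeries (pcoef nu) x
  = / 4 + x * PSeries (pcoef nu) x ^ 2.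
Proof.
intros Hnu Hx.
assert (H0 : ex_pseries (pcoef nu) x) by (apply CV_radius_inside; auto).
assert (H1 : ex_pseries (PS_derive (pcoef nu)) x)
  by (apply CV_radius_inside; rewrite CV_radius_derive; auto).
rewrite <- PSeries_incr_1, <- PSeries_scal, <- PSeries_plus;
  [|apply ex_pseries_incr_1; auto|apply ex_pseries_scal; [apply Rmult_comm|auto]].
replace (PSeries (pcoef nu) x ^ 2) with (PSeries (PS_mult (pcoef nu) (pcoef nu)) x)
  by (rewrite PSeries_mult by auto; ring).
rewrite (PSeries_decr_1 (PS_plus _ _)).
2:{ apply ex_pseries_plus; [apply ex_pseries_incr_1|apply ex_pseries_scal; [apply Rmult_comm|]]; auto. }
f_equal; [|f_equal; apply PSeries_ext; intros n].
- change (0 + (nu + 1) * pcoef nu 0 = / 4). rewrite pcoef_0; field; lra.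
- rewrite <- pcoef_S by auto.
  change (INR (S n) * pcoef nu (S n) + (nu + 1) * pcoef nu (S n)
    = (INR (S n) + (nu + 1)) * pcoef nu (S n)). ring.
Qed.

(* With D = p h + h', the Riccati equation and Bessel's equation give
   w D' + (nu + 1) D = w p D, whose only power series solution is 0. *)
Lemma pcoef_mult_hcoef (nu : R) (n : nat) : 0 < nu ->
  PS_mult (pcoef nu) (hcoef nu) n = - PS_derive (hcoef nu) n.
Proof.
intros Hnu. destruct (h_first_zero nu Hnu) as (X & HX0 & _ & HX).
set (c := pcoef nu). set (a := hcoef nu).
assert (Hc : forall x, Rabs x < X -> Rbar_lt (Rabs x) (CV_radius c))
  by (intros; apply CV_radius_pcoef with X; auto).
assert (Ha : forall x, Rbar_lt (Rabs x) (CV_radius a)) by (intros; apply Rbar_lt_hcoef; auto).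
assert (Hda : forall x, Rbar_lt (Rabs x) (CV_radius (PS_derive a)))
  by (intros; rewrite CV_radius_derive; auto).
set (d := PS_plus (PS_mult c a) (PS_derive a)).
assert (Hexd : forall x, Rabs x < X -> ex_pseries d x).
{ intros x Hx; apply ex_pseries_plus; [apply ex_pseries_mult|apply CV_radius_inside]; auto. }
assert (Hd : forall x, Rabs x < X -> Rbar_lt (Rabs x) (CV_radius d)).
{ intros x Hx. set (y := (Rabs x + X) / 2). assert (Hx0 := Rabs_pos x).
  assert (Hy : Rabs y = y) by (apply Rabs_pos_eq; unfold y; lra).
  apply Rbar_lt_le_trans with (Rabs y); [simpl; unfold y in *; lra|].
  apply CV_radius_ge, Hexd. unfold y in *; lra. }
assert (HD : forall x, Rabs x < X -> PSeries d x = PSeries c x * PSeries a x + PSeries (PS_derive a) x).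
{ intros x Hx; unfold d; rewrite PSeries_plus, PSeries_mult; auto;
    [apply ex_pseries_mult|apply CV_radius_inside]; auto. }
assert (HdD : forall x, Rabs x < X -> PSeries (PS_derive d) x =
  PSeries (PS_derive c) x * PSeries a x + PSeries c x * PSeries (PS_derive a) x
  + PSeries (PS_derive (PS_derive a)) x).
{ intros x Hx. rewrite <- Derive_PSeries by auto.
  apply is_derive_unique.
  apply is_derive_ext_loc with (fun x => PSeries c x * PSeries a x + PSeries (PS_derive a) x).
  - assert (Hr : 0 < X - Rabs x) by lra. exists (mkposreal _ Hr); intros y Hy.
    change (Rabs (y - x) < X - Rabs x) in Hy. symmetry; apply HD.
    pose proof (Rabs_triang_inv y x). lra.
  - apply (is_derive_plus (V := R_NormedModule)); [|apply is_derive_PSeries; auto].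
    apply (is_derive_mult (PSeries c) (PSeries a)); try apply is_derive_PSeries; auto.
    apply Rmult_comm. }
(* The equation for [D] is derived between functions near 0, where the product rule is at hand, and
   then passed to the coefficients. *)
assert (HE : forall k, PS_plus (PS_incr_1 (PS_derive d)) (PS_scal (nu + 1) d) k
  = PS_incr_1 (PS_mult c d) k).
{ assert (Hexl : forall x, Rabs x < X -> ex_pseries (PS_plus (PS_incr_1 (PS_derive d)) (PS_scal (nu + 1) d)) x).
  { intros x Hx; apply ex_pseries_plus; [apply ex_pseries_incr_1, CV_radius_inside; rewrite CV_radius_derive; auto|].
    apply ex_pseries_scal; [apply Rmult_comm|auto]. }
  assert (Hexr : forall x, Rabs x < X -> ex_pseries (PS_incr_1 (PS_mult c d)) x).
  { intros x Hx; apply ex_pseries_incr_1, ex_pseries_mult; auto. }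
  assert (HX2 : Rabs (X / 2) < X) by (rewrite Rabs_pos_eq; lra).
  assert (HX3 : Rbar_lt 0 (Rabs (X / 2))) by (simpl; rewrite Rabs_pos_eq; lra).
  intros k; apply PSeries_ext_recip.
  - apply Rbar_lt_le_trans with (Rabs (X / 2)); auto. apply CV_radius_ge; auto.
  - apply Rbar_lt_le_trans with (Rabs (X / 2)); auto. apply CV_radius_ge; auto.
  - exists (mkposreal _ HX0); intros x Hx. change (Rabs (x - 0) < X) in Hx.
    rewrite Rminus_0_r in Hx.
    rewrite PSeries_plus, !PSeries_incr_1, PSeries_scal, PSeries_mult; auto.
    + rewrite HdD, HD by auto.
      pose proof (riccati_pseries nu x Hnu (Hc x Hx)) as H1.
      pose proof (bessel_ode nu x Hnu) as H2. fold c in H1. fold a in H2.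
      set (p := PSeries c x) in *. set (h := PSeries a x) in *.
      set (dp := PSeries (PS_derive c) x) in *. set (dh := PSeries (PS_derive a) x) in *.
      set (d2h := PSeries (PS_derive (PS_derive a)) x) in *.
      transitivity ((x * dp + (nu + 1) * p) * h + x * p * dh + (x * d2h + (nu + 1) * dh)); [ring|].
      rewrite H1. replace (x * d2h + (nu + 1) * dh) with (- h / 4) by lra. field.
    + apply ex_pseries_incr_1, CV_radius_inside; rewrite CV_radius_derive; auto.
    + apply ex_pseries_scal; [apply Rmult_comm|auto]. }
(* At index [k + 1] the left side is [(k + nu + 2) * d (S k)], while the right side involves only
   [d 0, ..., d k]. *)
assert (Hd0 : forall k, d k = 0).
{ induction k as [k IH] using (well_founded_induction Wf_nat.lt_wf).
  specialize (HE k). destruct k as [|k].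
  - change (0 + (nu + 1) * d O = 0) in HE. nra.
  - change (INR (S k) * d (S k) + (nu + 1) * d (S k) = PS_mult c d k) in HE.
    assert (E : PS_mult c d k = 0).
    { unfold PS_mult; apply sum_eq_R0; intros i Hi; rewrite IH by lia; ring. }
    pose proof (pos_INR (S k)). nra. }
specialize (Hd0 n). unfold d, PS_plus, plus in Hd0; simpl in Hd0. lra.
Qed.

Lemma pseries_mult_h (nu X x : R) : 0 < nu -> h_pos_below nu X -> Rabs x < X ->
  PSeries (pcoef nu) x * PSeries (hcoef nu) x = - PSeries (PS_derive (hcoef nu)) x.
Proof.
intros Hnu HX Hx.
rewrite <- PSeries_mult; [|apply CV_radius_pcoef with X; auto|apply Rbar_lt_hcoef; auto].
rewrite <- PSeries_opp. apply PSeries_ext; intros n. rewrite pcoef_mult_hcoef by auto. reflexivity.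
Qed.

(** * First zeros and the convexity equation on the real axis *)

Lemma PSeries_nonneg (a : nat -> R) (x : R) :
  (forall n, 0 <= a n) -> 0 <= x -> ex_pseries a x -> 0 <= PSeries a x.
Proof.
intros Ha Hx Hex. rewrite <- (PSeries_const_0 x). apply Series_le.
- intros n; rewrite Rmult_0_l; split; [lra|]. apply Rmult_le_pos; auto; apply pow_le; auto.
- destruct Hex as [l Hl]; exists l. exact (proj1 (is_pseries_R a x l) Hl).
Qed.

(* Taylor coefficients of P = 1 - z f'/f in the variable w = z^2. *)
Definition bcoef (nu : R) : nat -> R := PS_scal (2 / nu) (PS_incr_1 (pcoef nu)).

Lemma bcoef_S (nu : R) (n : nat) : bcoef nu (S n) = 2 / nu * pcoef nu n.
Proof. reflexivity. Qed.

Lemma bcoef_nonneg (nu : R) (n : nat) : 0 < nu -> 0 <= bcoef nu n.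
Proof.
intros Hnu; destruct n as [|n].
- unfold bcoef, PS_scal, PS_incr_1, scal, zero; simpl; unfold mult; simpl; lra.
- rewrite bcoef_S. apply Rmult_le_pos; [|left; apply pcoef_pos; auto].
  left; apply Rdiv_lt_0_compat; lra.
Qed.

Lemma PSeries_bcoef (nu x : R) : PSeries (bcoef nu) x = 2 / nu * (x * PSeries (pcoef nu) x).
Proof. unfold bcoef; rewrite PSeries_scal, PSeries_incr_1; reflexivity. Qed.

Lemma CV_radius_bcoef (nu : R) : 0 < nu -> CV_radius (bcoef nu) = CV_radius (pcoef nu).
Proof.
intros Hnu; unfold bcoef; rewrite CV_radius_scal, CV_radius_incr_1; auto.
apply Rgt_not_eq, Rdiv_lt_0_compat; lra.
Qed.

(** At [w = x ^ 2] this is [J_nu'] at [x] up to a positive constant and the factor [x ^ (nu - 1)].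
    It equals [h * (1 - P)] below [X], but in this form it is defined for all [w], beyond the
    convergence of [P]. *)
Definition Gfun (nu w : R) : R :=
  PSeries (hcoef nu) w + 2 * w * PSeries (PS_derive (hcoef nu)) w / nu.

Lemma Gfun_eq (nu X w : R) : 0 < nu -> h_pos_below nu X -> Rabs w < X ->
  Gfun nu w = PSeries (hcoef nu) w * (1 - PSeries (bcoef nu) w).
Proof.
intros Hnu HX Hw. unfold Gfun. pose proof (pseries_mult_h nu X w Hnu HX Hw) as H.
rewrite PSeries_bcoef.
replace (PSeries (PS_derive (hcoef nu)) w)
  with (- (PSeries (pcoef nu) w * PSeries (hcoef nu) w)) by lra.
field; lra.
Qed.

Lemma ex_derive_Gfun (nu w : R) : 0 < nu -> ex_derive (Gfun nu) w.
Proof.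
intros Hnu; unfold Gfun.
assert (H1 := is_derive_h nu w Hnu). assert (H2 := is_derive_dh nu w Hnu).
auto_derive; repeat split; auto; eexists; eauto.
Qed.

Lemma is_derive_Rpower_mult (phi : R -> R) (dphi y x : R) : 0 < x -> is_derive phi x dphi ->
  is_derive (fun x => Rpower x y * phi x) x (Rpower x (y - 1) * (y * phi x + x * dphi)).
Proof.
intros Hx Hphi.
assert (H1 : is_derive (fun x => Rpower x y) x (y * Rpower x (y - 1)))
  by (apply is_derive_Reals, derivable_pt_lim_power; auto).
replace (Rpower x (y - 1) * (y * phi x + x * dphi))
  with (plus (mult (y * Rpower x (y - 1)) (phi x)) (mult (Rpower x y) dphi)).
- apply (is_derive_mult (fun x => Rpower x y) phi); auto. apply Rmult_comm.
- replace (Rpower x y) with (Rpower x (y - 1) * x).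
  + unfold plus, mult; simpl; ring.
  + rewrite <- (Rpower_1 x) at 2 by auto. rewrite <- Rpower_plus. f_equal; ring.
Qed.

Lemma Gfun_first_zero (nu X : R) : 0 < nu -> 0 < X -> PSeries (hcoef nu) X = 0 ->
  h_pos_below nu X ->
  exists Y, 0 < Y < X /\ Gfun nu Y = 0 /\ forall w, 0 <= w < Y -> 0 < Gfun nu w.
Proof.
intros Hnu HX0 HhX HX.
assert (Hder : forall w, 0 < w -> is_derive (fun w => Rpower w (nu / 2) * PSeries (hcoef nu) w) w
   (Rpower w (nu / 2 - 1) * (nu / 2 * Gfun nu w))).
{ intros w Hw. replace (nu / 2 * Gfun nu w)
    with (nu / 2 * PSeries (hcoef nu) w + w * PSeries (PS_derive (hcoef nu)) w)
    by (unfold Gfun; field; lra).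
  apply is_derive_Rpower_mult; auto. apply is_derive_h; auto. }
(* Up to a constant this function is [J_nu] at the square root of [w]. It falls from a positive
   value at [X / 2] to 0 at [X]; starting at 0 is avoided, since [Rpower] is meaningful only at
   positive bases. *)
destruct (MVT_cor2 (fun w => Rpower w (nu / 2) * PSeries (hcoef nu) w)
  (fun w => Rpower w (nu / 2 - 1) * (nu / 2 * Gfun nu w)) (X / 2) X) as (b & Hb & Hbx); [lra| |].
{ intros c Hc; apply is_derive_Reals, Hder; lra. }
assert (HG : Gfun nu b <= 0).
{ rewrite HhX, Rmult_0_r in Hb.
  assert (H1 : 0 < Rpower (X / 2) (nu / 2) * PSeries (hcoef nu) (X / 2)).
  { apply Rmult_lt_0_compat; [apply exp_pos|apply HX; lra]. }
  apply Rnot_lt_le; intros Hg.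
  assert (0 < Rpower b (nu / 2 - 1) * (nu / 2 * Gfun nu b)).
  { apply Rmult_lt_0_compat; [apply exp_pos|apply Rmult_lt_0_compat; lra]. }
  nra. }
destruct (first_zero (Gfun nu) b) as (c & Hc & Hc0 & Hcp); auto; [lra| | |].
- intros x _. apply (ex_derive_continuous (K := R_AbsRing) (V := R_NormedModule)).
  apply ex_derive_Gfun; auto.
- unfold Gfun; rewrite PSeries_hcoef_0. lra.
- exists c; split; [lra|split; auto].
Qed.

(** This is [(1 - P) * (alpha - Q)] with [Q = 1 - P - 2 * w * P' / (1 - P)]. Clearing the
    denominator replaces the limit of [Q] at the zero of [1 - P] by a value, [2 * w * P' > 0], so
    that a change of sign can be used. *)
Definition Kfun (nu alpha w : R) : R :=
  2 * w * PSeries (PS_derive (bcoef nu)) w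
  - (1 - PSeries (bcoef nu) w) * (1 - PSeries (bcoef nu) w - alpha).

Lemma Kfun_first_zero (nu alpha X Y : R) : 0 < nu -> alpha < 1 -> h_pos_below nu X ->
  0 < Y < X -> Gfun nu Y = 0 ->
  exists r, 0 < r < Y /\ Kfun nu alpha r = 0 /\ forall w, 0 <= w < r -> Kfun nu alpha w < 0.
Proof.
intros Hnu Halpha HX HY HGY.
assert (HCV : forall w, 0 <= w <= Y -> Rbar_lt (Rabs w) (CV_radius (bcoef nu))).
{ intros w Hw; rewrite CV_radius_bcoef by auto. apply CV_radius_pcoef with X; auto.
  rewrite Rabs_pos_eq; lra. }
assert (HKY : 0 < Kfun nu alpha Y).
{ unfold Kfun.
  rewrite Gfun_eq with (X := X) in HGY by (auto; rewrite Rabs_pos_eq; lra).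
  assert (HhY : 0 < PSeries (hcoef nu) Y) by (apply HX; lra).
  assert (HP : 1 - PSeries (bcoef nu) Y = 0) by nra. rewrite HP.
  assert (Hex : ex_pseries (PS_derive (bcoef nu)) Y)
    by (apply CV_radius_inside; rewrite CV_radius_derive; apply HCV; lra).
  (* The constant coefficient of [P'], which is [2 / nu * pcoef nu 0], is positive, and the others
     are nonnegative. *)
  assert (0 < PSeries (PS_derive (bcoef nu)) Y); [|nra].
  rewrite PSeries_decr_1 by auto.
  assert (0 <= PSeries (PS_decr_1 (PS_derive (bcoef nu))) Y).
  { apply PSeries_nonneg; [|lra|].
    - intros n; unfold PS_decr_1, PS_derive. apply Rmult_le_pos; [apply pos_INR|apply bcoef_nonneg; auto].
    - apply CV_radius_inside; rewrite CV_radius_decr_1, CV_radius_derive; apply HCV; lra. }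
  assert (0 < PS_derive (bcoef nu) 0).
  { unfold PS_derive. rewrite bcoef_S. simpl.
    apply Rmult_lt_0_compat; [lra|apply Rmult_lt_0_compat; [apply Rdiv_lt_0_compat; lra|apply pcoef_pos; auto]]. }
  nra. }
destruct (first_zero (fun w => - Kfun nu alpha w) Y) as (c & Hc & Hc0 & Hcp); [lra| | |lra|].
- intros w Hw. apply (ex_derive_continuous (K := R_AbsRing) (V := R_NormedModule)).
  assert (H1 := is_derive_PSeries _ _ (HCV w Hw)).
  assert (H2 : is_derive (PSeries (PS_derive (bcoef nu))) w
            (PSeries (PS_derive (PS_derive (bcoef nu))) w)).
  { apply is_derive_PSeries; rewrite CV_radius_derive; auto. }
  unfold Kfun. auto_derive; repeat split; auto; eexists; eauto.
- unfold Kfun. rewrite PSeries_bcoef. nra.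
- exists c; repeat split; try lra.
  + destruct (Rle_lt_or_eq_dec c Y) as [|He]; try lra. subst; lra.
  + intros w Hw; specialize (Hcp w Hw); lra.
Qed.

(** Zeros and logarithmic derivatives do not see the constant, so only its sign is exported. *)
Lemma BesselJ_eq (nu : R) : 0 < nu -> exists c, 0 < c /\
  forall x, 0 < x -> BesselJ nu x = c * (Rpower x nu * PSeries (hcoef nu) (x ^ 2)).
Proof.
intros Hnu. assert (HG : 0 < Gamma (nu + 1)) by (apply Gamma_pos; lra).
exists (Rpower (/ 2) nu / Gamma (nu + 1)); split.
{ apply Rdiv_lt_0_compat; auto; apply exp_pos. }
intros x Hx; unfold BesselJ, PSeries.
rewrite <- !Series_scal_l. apply Series_ext; intros n.
assert (Hn := pos_INR n).
assert (HGn : 0 < Gamma (INR n + nu + 1)) by (apply Gamma_pos; lra).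
assert (HF := INR_fact_lt_0 n).
assert (H := hcoef_Gamma nu n Hnu).
assert (H4 : 0 < 4 ^ n) by (apply pow_lt; lra).
replace (hcoef nu n) with ((-1) ^ n * Gamma (nu + 1) / (INR (fact n) * Gamma (INR n + nu + 1)) / 4 ^ n)
  by (rewrite H; field; lra).
rewrite Rpower_plus. replace (2 * INR n) with (INR (2 * n)) by (rewrite mult_INR; reflexivity).
rewrite Rpower_pow by lra.
unfold Rdiv at 2 3. rewrite <- Rpower_mult_distr by lra.
rewrite Rpow_mult_distr, !pow_mult, pow_inv.
replace ((/ 2 ^ 2) ^ n) with (/ 4 ^ n) by (rewrite <- pow_inv; f_equal; field).
field; lra.
Qed.

Lemma is_derive_comp_sqr (phi : R -> R) (dphi x : R) :
  is_derive phi (x ^ 2) dphi -> is_derive (fun x => phi (x ^ 2)) x (2 * x * dphi).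
Proof.
intros H. apply (is_derive_comp phi (fun x => x ^ 2)); auto.
auto_derive; auto; ring.
Qed.

Lemma locally_pos (x : R) (Q : R -> Prop) : 0 < x -> (forall y, 0 < y -> Q y) -> locally x Q.
Proof.
intros Hx HQ; exists (mkposreal x Hx); intros y Hy; apply HQ.
change (Rabs (y - x) < x) in Hy. apply Rabs_def2 in Hy; lra.
Qed.

Lemma BesselJ_derive_eq (nu c : R) : 0 < nu ->
  (forall x, 0 < x -> BesselJ nu x = c * (Rpower x nu * PSeries (hcoef nu) (x ^ 2))) ->
  forall x, 0 < x -> Derive (BesselJ nu) x = c * (Rpower x (nu - 1) * (nu * Gfun nu (x ^ 2))).
Proof.
intros Hnu HJ x Hx. apply is_derive_unique.
apply is_derive_ext_loc with (fun x => c * (Rpower x nu * PSeries (hcoef nu) (x ^ 2))).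
{ apply locally_pos; auto. intros y Hy; symmetry; apply HJ; auto. }
apply (is_derive_scal (fun x => Rpower x nu * PSeries (hcoef nu) (x ^ 2))).
replace (nu * Gfun nu (x ^ 2)) with (nu * PSeries (hcoef nu) (x ^ 2)
  + x * (2 * x * PSeries (PS_derive (hcoef nu)) (x ^ 2))) by (unfold Gfun; field; lra).
apply (is_derive_Rpower_mult (fun x => PSeries (hcoef nu) (x ^ 2))); auto.
apply is_derive_comp_sqr, is_derive_h; auto.
Qed.

(** Differentiating the product form [h * (1 - P)] brings in [P'] in place of [h'']. *)
Lemma is_derive_Gfun (nu X w : R) : 0 < nu -> h_pos_below nu X -> Rabs w < X ->
  is_derive (Gfun nu) w (PSeries (PS_derive (hcoef nu)) w * (1 - PSeries (bcoef nu) w)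
    - PSeries (hcoef nu) w * PSeries (PS_derive (bcoef nu)) w).
Proof.
intros Hnu HX Hw.
apply is_derive_ext_loc with (fun w => PSeries (hcoef nu) w * (1 - PSeries (bcoef nu) w)).
{ assert (Hr : 0 < X - Rabs w) by lra. exists (mkposreal _ Hr); intros y Hy.
  change (Rabs (y - w) < X - Rabs w) in Hy. symmetry; apply Gfun_eq with X; auto.
  pose proof (Rabs_triang_inv y w). lra. }
assert (H1 := is_derive_h nu w Hnu).
assert (H2 : is_derive (PSeries (bcoef nu)) w (PSeries (PS_derive (bcoef nu)) w)).
{ apply is_derive_PSeries. rewrite CV_radius_bcoef by auto. apply CV_radius_pcoef with X; auto. }
auto_derive.
- repeat split; eexists; eauto.
- change (Derive (fun x => PSeries (hcoef nu) x) w) with (Derive (PSeries (hcoef nu)) w).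
  change (Derive (fun x => PSeries (bcoef nu) x) w) with (Derive (PSeries (bcoef nu)) w).
  rewrite (is_derive_unique _ _ _ H1), (is_derive_unique _ _ _ H2); ring.
Qed.

(** With [w = x ^ 2], [x J'/J = nu * (1 - P)] and [1 + x J''/J' = nu * (1 - P) - 2 * w * P' / (1 -
    P)]. In the sum the multiples of [nu] cancel, and [1/nu] leaves [1 - P]. *)
Lemma convexity_lhs_eq (nu X x : R) : 0 < nu -> h_pos_below nu X -> 0 < x -> x ^ 2 < X ->
  0 < Gfun nu (x ^ 2) ->
  BesselJ nu x <> 0 /\ Derive (BesselJ nu) x <> 0 /\
  1 + x * Derive_n (BesselJ nu) 2 x / Derive (BesselJ nu) x
    + (1 / nu - 1) * (x * Derive (BesselJ nu) x / BesselJ nu x)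
  = 1 - PSeries (bcoef nu) (x ^ 2)
    - 2 * x ^ 2 * PSeries (PS_derive (bcoef nu)) (x ^ 2) / (1 - PSeries (bcoef nu) (x ^ 2)).
Proof.
intros Hnu HX Hx HxX HG.
destruct (BesselJ_eq nu Hnu) as (c & Hc & HJ).
assert (HdJ := BesselJ_derive_eq nu c Hnu HJ).
assert (Hx2 : 0 < x ^ 2) by (apply pow_lt; auto).
assert (Hax : Rabs (x ^ 2) < X) by (rewrite Rabs_pos_eq; lra).
assert (Hh : 0 < PSeries (hcoef nu) (x ^ 2)) by (apply HX; lra).
assert (HGe := Gfun_eq nu X (x ^ 2) Hnu HX Hax).
assert (Hph := pseries_mult_h nu X (x ^ 2) Hnu HX Hax).
assert (Hb := PSeries_bcoef nu (x ^ 2)).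
assert (Hd2 : Derive_n (BesselJ nu) 2 x = c * (Rpower x (nu - 1 - 1) *
  ((nu - 1) * (nu * Gfun nu (x ^ 2)) + x * (2 * x * (nu * (PSeries (PS_derive (hcoef nu)) (x ^ 2)
    * (1 - PSeries (bcoef nu) (x ^ 2))
    - PSeries (hcoef nu) (x ^ 2) * PSeries (PS_derive (bcoef nu)) (x ^ 2))))))).
{ change (Derive (Derive (BesselJ nu)) x = c * (Rpower x (nu - 1 - 1) *
    ((nu - 1) * (nu * Gfun nu (x ^ 2)) + x * (2 * x * (nu * (PSeries (PS_derive (hcoef nu)) (x ^ 2)
    * (1 - PSeries (bcoef nu) (x ^ 2))
    - PSeries (hcoef nu) (x ^ 2) * PSeries (PS_derive (bcoef nu)) (x ^ 2))))))).
  apply is_derive_unique.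
  apply is_derive_ext_loc with (fun x => c * (Rpower x (nu - 1) * (nu * Gfun nu (x ^ 2)))).
  { apply locally_pos; auto. intros y Hy; symmetry; apply HdJ; auto. }
  apply (is_derive_scal (fun x => Rpower x (nu - 1) * (nu * Gfun nu (x ^ 2)))).
  apply (is_derive_Rpower_mult (fun x => nu * Gfun nu (x ^ 2))); auto.
  apply (is_derive_comp_sqr (fun w => nu * Gfun nu w)).
  apply is_derive_scal. apply is_derive_Gfun with X; auto. }
assert (HP1 : 0 < Rpower x (nu - 1)) by apply exp_pos.
assert (HP2 : 0 < Rpower x (nu - 1 - 1)) by apply exp_pos.
assert (E1 : Rpower x nu = x * Rpower x (nu - 1)).
{ rewrite <- (Rpower_1 x) at 2 by auto. rewrite <- Rpower_plus. f_equal; ring. }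
assert (E2 : Rpower x (nu - 1) = x * Rpower x (nu - 1 - 1)).
{ rewrite <- (Rpower_1 x) at 2 by auto. rewrite <- Rpower_plus. f_equal; ring. }
rewrite Hd2, HdJ, HJ by auto. rewrite E1, E2.
assert (HP : 0 < 1 - PSeries (bcoef nu) (x ^ 2)) by (rewrite HGe in HG; nra).
rewrite HGe in *.
set (h := PSeries (hcoef nu) (x ^ 2)) in *. set (P := PSeries (bcoef nu) (x ^ 2)) in *.
set (dP := PSeries (PS_derive (bcoef nu)) (x ^ 2)) in *.
set (p := PSeries (pcoef nu) (x ^ 2)) in *.
replace (PSeries (PS_derive (hcoef nu)) (x ^ 2)) with (- (p * h)) by (unfold p, h in *; lra).
set (q := Rpower x (nu - 1 - 1)) in *.
split; [|split].
- apply Rgt_not_eq. repeat apply Rmult_lt_0_compat; auto.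
- apply Rgt_not_eq. repeat apply Rmult_lt_0_compat; auto.
- replace p with (nu * P / (2 * x ^ 2)) by (rewrite Hb; field; lra).
  field. repeat split; apply Rgt_not_eq; auto.
Qed.

(** * Complex derivatives *)

Definition is_Cderive (f : C -> C) (z l : C) : Prop :=
  is_derive (K := C_AbsRing) (V := C_NormedModule) f z l.

Lemma Cmod_le_minus_plus (x y : C) : Cmod x <= Cmod (x - y) + Cmod y.
Proof. replace x with ((x - y) + y)%C at 1 by ring. apply Cmod_triangle. Qed.

(** The inverse, the exponential and power series all admit explicit quadratic remainders, so one
    criterion serves for all three. *)
Lemma is_Cderive_of_quadratic (f : C -> C) (z l : C) (M d : R) : 0 < d ->
  (forall y, Cmod (y - z) < d -> Cmod (f y - f z - (y - z) * l)%C <= M * Cmod (y - z) ^ 2) ->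
  is_Cderive f z l.
Proof.
intros Hd H; split; [apply is_linear_scal_l|].
intros x Hx. apply (is_filter_lim_locally_unique (K := C_AbsRing) (V := AbsRing_NormedModule C_AbsRing)) in Hx.
subst x. intros eps.
assert (Hp : 0 < Rmin d (eps / (Rabs M + 1))).
{ apply Rmin_glb_lt; auto. apply Rdiv_lt_0_compat; [apply cond_pos|pose proof (Rabs_pos M); lra]. }
exists (mkposreal _ Hp); intros y Hy.
change (Cmod (y - z) < Rmin d (eps / (Rabs M + 1))) in Hy.
change (Cmod (f y - f z - (y - z) * l)%C <= eps * Cmod (y - z)).
assert (H1 : Cmod (y - z) < d) by (eapply Rlt_le_trans; [apply Hy|apply Rmin_l]).
assert (H2 : Cmod (y - z) < eps / (Rabs M + 1)) by (eapply Rlt_le_trans; [apply Hy|apply Rmin_r]).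
specialize (H y H1). pose proof (Rabs_pos M). pose proof (Rle_abs M). pose proof (Cmod_ge_0 (y - z)).
apply (Rmult_lt_compat_r (Rabs M + 1)) in H2; [|lra].
unfold Rdiv in H2; rewrite Rmult_assoc, Rinv_l, Rmult_1_r in H2 by lra.
apply Rle_trans with (1 := H).
replace (M * Cmod (y - z) ^ 2) with ((M * Cmod (y - z)) * Cmod (y - z)) by ring.
apply Rmult_le_compat_r; auto. nra.
Qed.

(* [C_NormedModule] and [AbsRing_NormedModule C_AbsRing] carry the same norm but
   different uniform structures. *)
Lemma is_Cderive_AbsRing (f : C -> C) (z l : C) :
  is_Cderive f z l <-> is_derive (K := C_AbsRing) (V := AbsRing_NormedModule C_AbsRing) f z l.
Proof. split; intros [_ H]; (split; [apply is_linear_scal_l|exact H]). Qed.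

Lemma is_Cderive_ext (f g : C -> C) (z l : C) (r : R) : Cmod z < r ->
  (forall y, Cmod y < r -> f y = g y) -> is_Cderive f z l -> is_Cderive g z l.
Proof.
intros Hz H. apply is_derive_ext_loc.
assert (Hr : 0 < r - Cmod z) by lra. exists (mkposreal _ Hr); intros y Hy.
change (Cmod (y - z) < r - Cmod z) in Hy. apply H.
pose proof (Cmod_le_minus_plus y z). lra.
Qed.

Lemma is_Cderive_const (a z : C) : is_Cderive (fun _ => a) z (RtoC 0).
Proof. apply (is_derive_const (K := C_AbsRing) (V := C_NormedModule)). Qed.

Lemma is_Cderive_id (z : C) : is_Cderive (fun x => x) z (RtoC 1).
Proof. apply is_Cderive_AbsRing, (is_derive_id (K := C_AbsRing)). Qed.

Lemma is_Cderive_plus (f g : C -> C) (z lf lg : C) :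
  is_Cderive f z lf -> is_Cderive g z lg -> is_Cderive (fun x => f x + g x)%C z (lf + lg)%C.
Proof. apply (is_derive_plus (K := C_AbsRing) (V := C_NormedModule)). Qed.

Lemma is_Cderive_mult (f g : C -> C) (z lf lg : C) :
  is_Cderive f z lf -> is_Cderive g z lg ->
  is_Cderive (fun x => f x * g x)%C z (lf * g z + f z * lg)%C.
Proof. rewrite !is_Cderive_AbsRing; intros Hf Hg.
exact (is_derive_mult (K := C_AbsRing) f g z lf lg Hf Hg Cmult_comm).
 Qed.

Lemma is_Cderive_comp (f g : C -> C) (z lf lg : C) :
  is_Cderive f (g z) lf -> is_Cderive g z lg -> is_Cderive (fun x => f (g x)) z (lg * lf)%C.
Proof. rewrite !is_Cderive_AbsRing; intros Hf Hg.
exact (is_derive_comp (K := C_AbsRing) (V := AbsRing_NormedModule C_AbsRing) f g z lf lg Hf Hg).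
 Qed.

Lemma is_Cderive_inv (z : C) : z <> RtoC 0 -> is_Cderive Cinv z (- / (z * z))%C.
Proof.
intros Hz. assert (Hm : 0 < Cmod z) by (apply Cmod_gt_0; auto).
(* Within [Cmod z / 2] of [z] one has [Cmod y > Cmod z / 2], and the remainder is
   [(y - z) ^ 2 / (y * z ^ 2)]. *)
apply is_Cderive_of_quadratic with (2 / Cmod z ^ 3) (Cmod z / 2); [lra|].
intros y Hy.
assert (Hym : Cmod z / 2 < Cmod y).
{ pose proof (Cmod_le_minus_plus z y) as Ht.
  replace (z - y)%C with (- (y - z))%C in Ht by ring. rewrite Cmod_opp in Ht. lra. }
assert (Hy0 : y <> RtoC 0) by (apply Cmod_gt_0; lra).
replace (/ y - / z - (y - z) * - / (z * z))%C with ((y - z) * (y - z) * (/ y * (/ z * / z)))%C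
  by (field; auto).
rewrite !Cmod_mult, !Cmod_inv by auto.
assert (/ Cmod y <= 2 / Cmod z).
{ replace (2 / Cmod z) with (/ (Cmod z / 2)) by (field; lra). apply Rinv_le_contravar; lra. }
replace (2 / Cmod z ^ 3 * Cmod (y - z) ^ 2)
  with (Cmod (y - z) * Cmod (y - z) * (2 / Cmod z * (/ Cmod z * / Cmod z))) by (field; lra).
apply Rmult_le_compat_l; [apply Rmult_le_pos; apply Cmod_ge_0|].
apply Rmult_le_compat_r; auto.
assert (0 < / Cmod z) by (apply Rinv_0_lt_compat; auto). nra.
Qed.

(** A chain rule across two scalar fields. It turns statements on the disc into statements about
    functions of [t] in [0, 1], where integration and constancy are available. *)
Lemma is_Cderive_ray (f : C -> C) (z l : C) (t : R) :
  is_Cderive f (RtoC t * z)%C l ->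
  is_derive (K := R_AbsRing) (V := C_R_NormedModule) (fun t => f (RtoC t * z)%C) t (z * l)%C.
Proof.
intros [_ H]; split; [apply is_linear_scal_l|].
intros x Hx. apply (is_filter_lim_locally_unique (K := R_AbsRing) (V := R_NormedModule)) in Hx.
subst x. intros eps.
assert (He : 0 < eps / (Cmod z + 1)).
{ apply Rdiv_lt_0_compat; [apply cond_pos|pose proof (Cmod_ge_0 z); lra]. }
destruct (H (RtoC t * z)%C (fun P HP => HP) (mkposreal _ He)) as [d Hd].
pose proof (Cmod_ge_0 z) as Hz0.
assert (Hp : 0 < d / (Cmod z + 1)) by (apply Rdiv_lt_0_compat; [apply cond_pos|lra]).
exists (mkposreal _ Hp); intros s Hs.
change (Rabs (s - t) < d / (Cmod z + 1)) in Hs.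
assert (E : (RtoC s * z - RtoC t * z)%C = (RtoC (s - t) * z)%C) by (rewrite RtoC_minus; ring).
assert (Hb : Cmod (RtoC s * z - RtoC t * z)%C < d).
{ rewrite E, Cmod_mult, Cmod_R.
  apply (Rmult_lt_compat_r (Cmod z + 1)) in Hs; [|lra].
  unfold Rdiv in Hs; rewrite Rmult_assoc, Rinv_l, Rmult_1_r in Hs by lra.
  pose proof (Rabs_pos (s - t)). nra. }
specialize (Hd (RtoC s * z)%C Hb).
change (Cmod (f (RtoC s * z) - f (RtoC t * z) - (RtoC s * z - RtoC t * z) * l)%C
  <= eps / (Cmod z + 1) * Cmod (RtoC s * z - RtoC t * z)%C) in Hd.
rewrite E in Hd.
assert (Hs0 := Rabs_pos (s - t)).
match goal with |- norm ?u <= _ * norm ?v =>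
  change (norm v) with (Rabs (s - t));
  replace u with (f (RtoC s * z) - f (RtoC t * z) - RtoC (s - t) * z * l)%C;
  [change (norm (K := R_AbsRing) (V := C_R_NormedModule)
     (f (RtoC s * z) - f (RtoC t * z) - RtoC (s - t) * z * l)%C <= eps * Rabs (s - t)) |]
end.
rewrite <- Cmod_norm.
- apply Rle_trans with (1 := Hd). rewrite Cmod_mult, Cmod_R.
  replace (eps / (Cmod z + 1) * (Rabs (s - t) * Cmod z))
    with (eps * Rabs (s - t) * (Cmod z / (Cmod z + 1))) by (field; lra).
  rewrite <- (Rmult_1_r (eps * Rabs (s - t))) at 2.
  apply Rmult_le_compat_l; [apply Rmult_le_pos; auto; left; apply cond_pos|].
  apply (Rmult_le_reg_r (Cmod z + 1)); [lra|].
  unfold Rdiv; rewrite Rmult_assoc, Rinv_l by lra; lra.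
- rewrite <- Cmult_assoc. apply injective_projections; simpl;
    unfold minus, plus, opp, scal; simpl; unfold mult; simpl; ring.
Qed.

(** * The complex exponential *)

Lemma Cmod_pair_le (x y : R) : Cmod (x, y) <= Rabs x + Rabs y.
Proof.
replace (x, y) with (RtoC x + Ci * RtoC y)%C.
- eapply Rle_trans; [apply Cmod_triangle|]. rewrite Cmod_mult, Cmod_Ci, !Cmod_R; lra.
- apply injective_projections; simpl; ring.
Qed.

Lemma Cexp_plus (x y : C) : Cexp (x + y) = (Cexp x * Cexp y)%C.
Proof.
unfold Cexp; destruct x as [a b], y as [c d]; simpl.
rewrite exp_plus, cos_plus, sin_plus. apply injective_projections; simpl; ring.
Qed.

Lemma Cexp_0 : Cexp (RtoC 0) = RtoC 1.
Proof. unfold Cexp; simpl; rewrite exp_0, cos_0, sin_0; apply injective_projections; simpl; ring. Qed.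

Lemma Cexp_neq_0 (x : C) : Cexp x <> RtoC 0.
Proof.
intros H. assert (E : (Cexp x * Cexp (- x))%C = RtoC 1).
{ rewrite <- Cexp_plus, <- Cexp_0; f_equal; ring. }
rewrite H, Cmult_0_l in E. injection E; lra.
Qed.

(** Both sides come from [1 + x <= exp x]: at [x] for the lower bound, and at [- x], in the form
    [exp x * (1 - x) <= 1], for the upper one. *)
Lemma exp_taylor_1 (x : R) : Rabs x <= / 2 -> Rabs (exp x - 1 - x) <= 2 * x ^ 2.
Proof.
intros Hx. apply Rabs_le_between in Hx.
pose proof (exp_ineq1_le x) as H1. pose proof (exp_ineq1_le (- x)) as H2.
rewrite exp_Ropp in H2. pose proof (exp_pos x) as H3.
assert (H4 : exp x * (1 - x) <= 1).
{ apply (Rmult_le_compat_l (exp x)) in H2; [|lra]. rewrite Rinv_r in H2 by lra. lra. }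
rewrite Rabs_pos_eq by lra. nra.
Qed.

Lemma Rabs_sin_le (y : R) : Rabs (sin y) <= Rabs y.
Proof.
destruct (MVT_gen sin 0 y cos) as (c & _ & Hc).
- intros x _; apply is_derive_Reals, derivable_pt_lim_sin.
- intros x _; apply continuity_sin.
- rewrite sin_0, !Rminus_0_r in Hc. rewrite Hc, Rabs_mult.
  pose proof (COS_bound c). pose proof (Rabs_pos y).
  assert (Rabs (cos c) <= 1) by (apply Rabs_le; lra). nra.
Qed.

Lemma Rabs_cos_minus_1 (y : R) : Rabs (cos y - 1) <= y ^ 2.
Proof.
destruct (MVT_gen cos 0 y (fun x => - sin x)) as (c & Hcy & Hc).
- intros x _; apply is_derive_Reals, derivable_pt_lim_cos.
- intros x _; apply continuity_cos.
- rewrite cos_0, !Rminus_0_r in Hc. rewrite Hc, Rabs_mult, Rabs_Ropp.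
  pose proof (Rabs_sin_le c). pose proof (Rabs_pos y).
  assert (Rabs c <= Rabs y).
  { unfold Rmin, Rmax in Hcy; destruct (Rle_dec 0 y); unfold Rabs; repeat destruct Rcase_abs; lra. }
  rewrite <- (pow2_abs y). simpl. nra.
Qed.

Lemma Rabs_sin_minus_id (y : R) : Rabs y <= 1 -> Rabs (sin y - y) <= y ^ 2.
Proof.
intros Hy. destruct (MVT_gen (fun x => sin x - x) 0 y (fun x => cos x - 1)) as (c & Hcy & Hc).
- intros x _; auto_derive; auto; ring.
- intros x _; apply continuity_minus; [apply continuity_sin|apply derivable_continuous, derivable_id].
- rewrite sin_0, !Rminus_0_r in Hc. rewrite Hc, Rabs_mult.
  pose proof (Rabs_cos_minus_1 c). pose proof (Rabs_pos y). pose proof (Rabs_pos c).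
  assert (Rabs c <= Rabs y).
  { unfold Rmin, Rmax in Hcy; destruct (Rle_dec 0 y); unfold Rabs; repeat destruct Rcase_abs; lra. }
  rewrite <- (pow2_abs c) in *. rewrite <- (pow2_abs y). simpl in *. nra.
Qed.

(** The functional equation reduces the remainder to that at 0, estimated in real and imaginary
    parts. The constant 10 is generous: the two estimates add up to [3 * a ^ 2 + 4 * b ^ 2]. *)
Lemma is_Cderive_Cexp (z : C) : is_Cderive Cexp z (Cexp z).
Proof.
apply is_Cderive_of_quadratic with (10 * Cmod (Cexp z)) (/ 2); [lra|].
intros y Hy. set (k := (y - z)%C) in *.
replace y with (z + k)%C by (unfold k; ring). rewrite Cexp_plus.
replace (Cexp z * Cexp k - Cexp z - k * Cexp z)%C with (Cexp z * (Cexp k - 1 - k))%C by ring.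
rewrite Cmod_mult, (Rmult_comm 10), Rmult_assoc.
apply Rmult_le_compat_l; [apply Cmod_ge_0|].
destruct k as [a b]. clear y.
pose proof (Cmod2_alt (a, b)) as H2; simpl fst in H2; unfold Re, Im in H2; simpl fst in H2; simpl snd in H2.
rewrite H2.
pose proof (Rmax_Cmod (a, b)) as Hm; simpl in Hm.
assert (Ha : Rabs a <= / 2) by (pose proof (Rmax_l (Rabs a) (Rabs b)); lra).
assert (Hb : Rabs b <= / 2) by (pose proof (Rmax_r (Rabs a) (Rabs b)); lra).
pose proof (exp_taylor_1 a Ha) as E1.
pose proof (Rabs_cos_minus_1 b) as E2.
pose proof (Rabs_sin_minus_id b ltac:(lra)) as E3.
pose proof (Rabs_sin_le b) as E4.
assert (Ea : 0 < exp a <= 2).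
{ split; [apply exp_pos|]. apply Rabs_le_between in E1. apply Rabs_le_between in Ha. nra. }
assert (Ea1 : Rabs (exp a - 1) <= 2 * Rabs a).
{ replace (exp a - 1) with ((exp a - 1 - a) + a) by ring.
  eapply Rle_trans; [apply Rabs_triang|]. rewrite <- (pow2_abs a) in E1. pose proof (Rabs_pos a). nra. }
replace (Cexp (a, b) - 1 - (a, b))%C
  with ((exp a - 1 - a) + exp a * (cos b - 1), (exp a - 1) * sin b + (sin b - b)).
2:{ unfold Cexp; apply injective_projections; simpl; ring. }
eapply Rle_trans; [apply Cmod_pair_le|].
assert (B1 : Rabs ((exp a - 1 - a) + exp a * (cos b - 1)) <= 2 * a ^ 2 + 2 * b ^ 2).
{ eapply Rle_trans; [apply Rabs_triang|]. rewrite Rabs_mult, (Rabs_pos_eq (exp a)) by lra.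
  pose proof (Rabs_pos (cos b - 1)). nra. }
assert (B2 : Rabs ((exp a - 1) * sin b + (sin b - b)) <= a ^ 2 + 2 * b ^ 2).
{ eapply Rle_trans; [apply Rabs_triang|]. rewrite Rabs_mult.
  assert (Rabs (exp a - 1) * Rabs (sin b) <= 2 * Rabs a * Rabs b).
  { apply Rmult_le_compat; auto; apply Rabs_pos. }
  assert (2 * Rabs a * Rabs b <= Rabs a ^ 2 + Rabs b ^ 2) by (pose proof (pow2_ge_0 (Rabs a - Rabs b)); nra).
  rewrite !pow2_abs in *. lra. }
pose proof (pow2_ge_0 a). pose proof (pow2_ge_0 b). lra.
Qed.

(** * Complex power series with real coefficients *)

Lemma RtoC_m1 : RtoC (-1) = (- RtoC 1)%C.
Proof. rewrite <- RtoC_opp; f_equal; ring. Qed.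

Lemma ex_series_Rmult (k : R) (a : nat -> R) : ex_series a -> ex_series (fun n => k * a n).
Proof. intros H; exact (ex_series_scal (V := R_NormedModule) k a H). Qed.

Lemma Series_eq_0 (a : nat -> R) : (forall n, a n = 0) -> Series a = 0.
Proof.
intros Ha. rewrite <- (PSeries_const_0 0). apply Series_ext; intros n; rewrite Ha; ring.
Qed.

Definition ex_Cseries_abs (a : nat -> C) : Prop := ex_series (fun n => Cmod (a n)).

Lemma im_le_Cmod (c : C) : Rabs (Im c) <= Cmod c.
Proof. eapply Rle_trans; [apply Rmax_r|apply Rmax_Cmod]. Qed.

Lemma ex_series_Re_abs (a : nat -> C) : ex_Cseries_abs a -> ex_series (fun n => Rabs (Re (a n))).
Proof.
intros H; apply (ex_series_le (K := R_AbsRing) (V := R_CompleteNormedModule) _ (fun n => Cmod (a n))); auto.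
intros n; change (Rabs (Rabs (Re (a n))) <= Cmod (a n)). rewrite Rabs_Rabsolu; apply re_le_Cmod.
Qed.

Lemma ex_series_Im_abs (a : nat -> C) : ex_Cseries_abs a -> ex_series (fun n => Rabs (Im (a n))).
Proof.
intros H; apply (ex_series_le (K := R_AbsRing) (V := R_CompleteNormedModule) _ (fun n => Cmod (a n))); auto.
intros n; change (Rabs (Rabs (Im (a n))) <= Cmod (a n)). rewrite Rabs_Rabsolu; apply im_le_Cmod.
Qed.

Lemma ex_series_Re (a : nat -> C) : ex_Cseries_abs a -> ex_series (fun n => Re (a n)).
Proof. intros; apply ex_series_Rabs, ex_series_Re_abs; auto. Qed.

Lemma ex_series_Im (a : nat -> C) : ex_Cseries_abs a -> ex_series (fun n => Im (a n)).
Proof. intros; apply ex_series_Rabs, ex_series_Im_abs; auto. Qed.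

Lemma CSeries_ext (a b : nat -> C) : (forall n, a n = b n) -> CSeries a = CSeries b.
Proof. intros H; unfold CSeries; f_equal; apply Series_ext; intros n; rewrite H; auto. Qed.

Lemma CSeries_plus (a b : nat -> C) : ex_Cseries_abs a -> ex_Cseries_abs b ->
  CSeries (fun n => a n + b n)%C = (CSeries a + CSeries b)%C.
Proof.
intros Ha Hb; apply injective_projections; simpl;
  rewrite <- Series_plus; auto using ex_series_Re, ex_series_Im.
Qed.

Lemma CSeries_scal (k : C) (a : nat -> C) : ex_Cseries_abs a ->
  CSeries (fun n => k * a n)%C = (k * CSeries a)%C.
Proof.
intros Ha.
assert (Hr := ex_series_Re a Ha). assert (Hi := ex_series_Im a Ha).
apply injective_projections; simpl; rewrite <- !Series_scal_l.
- rewrite <- Series_minus; [reflexivity| |]; apply ex_series_Rmult; auto.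
- rewrite <- Series_plus; [reflexivity| |]; apply ex_series_Rmult; auto.
Qed.

Lemma ex_Cseries_abs_plus (a b : nat -> C) : ex_Cseries_abs a -> ex_Cseries_abs b ->
  ex_Cseries_abs (fun n => a n + b n)%C.
Proof.
intros Ha Hb.
apply (ex_series_le (K := R_AbsRing) (V := R_CompleteNormedModule) _ (fun n => Cmod (a n) + Cmod (b n))).
- intros n; change (Rabs (Cmod (a n + b n)) <= Cmod (a n) + Cmod (b n)).
  rewrite Rabs_pos_eq by apply Cmod_ge_0. apply Cmod_triangle.
- apply (ex_series_plus (V := R_NormedModule)); auto.
Qed.

Lemma ex_Cseries_abs_scal (k : C) (a : nat -> C) : ex_Cseries_abs a ->
  ex_Cseries_abs (fun n => k * a n)%C.
Proof.
intros Ha. apply ex_series_ext with (fun n => Cmod k * Cmod (a n)).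
- intros n; rewrite Cmod_mult; auto.
- apply ex_series_Rmult; auto.
Qed.

(* For [S = CSeries a], the series of [conj S * a n] has sum [|S|^2]. *)
Lemma Cmod_CSeries_le (a : nat -> C) : ex_Cseries_abs a ->
  Cmod (CSeries a) <= Series (fun n => Cmod (a n)).
Proof.
intros Ha. set (S := CSeries a).
assert (HS := CSeries_scal (Cconj S) a Ha). fold S in HS.
assert (HS' := ex_Cseries_abs_scal (Cconj S) a Ha).
assert (H2 : Cmod S ^ 2 <= Cmod S * Series (fun n => Cmod (a n))).
{ pose proof (Cmod2_conj S) as E. rewrite Cmult_comm, <- HS in E.
  apply (f_equal Re) in E.
  change (Cmod S ^ 2 = Series (fun n => Re (Cconj S * a n)%C)) in E. rewrite E.
  rewrite <- Series_scal_l.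
  eapply Rle_trans; [apply Rle_abs|].
  eapply Rle_trans; [apply Series_Rabs; apply ex_series_Re_abs; auto|].
  apply Series_le.
  - intros n; split; [apply Rabs_pos|]. eapply Rle_trans; [apply re_le_Cmod|].
    rewrite Cmod_mult, Cmod_conj; lra.
  - apply ex_series_Rmult; auto. }
destruct (Rle_lt_or_eq_dec 0 (Cmod S) (Cmod_ge_0 S)) as [Hp|He].
- apply (Rmult_le_reg_l (Cmod S)); auto. lra.
- rewrite <- He, <- (Series_eq_0 (fun _ => 0)) by auto.
  apply Series_le; auto. intros n; split; [lra|apply Cmod_ge_0].
Qed.

Definition CPS (c : nat -> R) (w : C) : C := CSeries (fun n => RtoC (c n) * w ^ n)%C.

Lemma Cmod_CPS_term (c : nat -> R) (w : C) (n : nat) :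
  Cmod (RtoC (c n) * w ^ n)%C = Rabs (c n * Cmod w ^ n).
Proof.
rewrite Cmod_mult, Cmod_R, Cmod_pow, Rabs_mult.
rewrite (Rabs_pos_eq (Cmod w ^ n)) by (apply pow_le, Cmod_ge_0); auto.
Qed.

Lemma ex_CPS (c : nat -> R) (w : C) : Rbar_lt (Cmod w) (CV_radius c) ->
  ex_Cseries_abs (fun n => RtoC (c n) * w ^ n)%C.
Proof.
intros H. apply ex_series_ext with (fun n => Rabs (c n * Cmod w ^ n)).
- intros n; rewrite Cmod_CPS_term; auto.
- apply CV_disk_inside. rewrite Rabs_pos_eq; auto. apply Cmod_ge_0.
Qed.

Lemma CPS_RtoC (c : nat -> R) (x : R) : CPS c (RtoC x) = RtoC (PSeries c x).
Proof.
apply injective_projections; simpl.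
- apply Series_ext; intros n; rewrite <- RtoC_pow; simpl; ring.
- apply Series_eq_0; intros n; rewrite <- RtoC_pow; simpl; ring.
Qed.

Lemma CPS_0 (c : nat -> R) : CPS c (RtoC 0) = RtoC (c 0%nat).
Proof. rewrite CPS_RtoC, PSeries_0; reflexivity. Qed.

Lemma CPS_ext (a b : nat -> R) (w : C) : (forall n, a n = b n) -> CPS a w = CPS b w.
Proof. intros H; apply CSeries_ext; intros n; rewrite H; auto. Qed.

Lemma CPS_scal (k : R) (c : nat -> R) (w : C) : Rbar_lt (Cmod w) (CV_radius c) ->
  CPS (PS_scal k c) w = (RtoC k * CPS c w)%C.
Proof.
intros H; unfold CPS; rewrite <- CSeries_scal by (apply ex_CPS; auto).
apply CSeries_ext; intros n. unfold PS_scal, scal; simpl; unfold mult; simpl.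
rewrite RtoC_mult; ring.
Qed.

Lemma CSeries_incr_1 (a : nat -> C) : ex_Cseries_abs a ->
  CSeries a = (a 0%nat + CSeries (fun n => a (S n)))%C.
Proof.
intros Ha; apply injective_projections; simpl; apply Series_incr_1;
  auto using ex_series_Re, ex_series_Im.
Qed.

Lemma CPS_incr_1 (c : nat -> R) (w : C) : Rbar_lt (Cmod w) (CV_radius c) ->
  CPS (PS_incr_1 c) w = (w * CPS c w)%C.
Proof.
intros H. unfold CPS at 1. rewrite CSeries_incr_1.
- unfold CPS; rewrite <- CSeries_scal by (apply ex_CPS; auto).
  change (PS_incr_1 c 0) with 0. rewrite Cmult_0_l, Cplus_0_l.
  apply CSeries_ext; intros n. rewrite Cpow_S. change (PS_incr_1 c (S n)) with (c n). ring.
- apply ex_CPS; rewrite CV_radius_incr_1; auto.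
Qed.

Lemma Cmod_CPS_le (c : nat -> R) (w : C) : (forall n, 0 <= c n) ->
  Rbar_lt (Cmod w) (CV_radius c) -> Cmod (CPS c w) <= PSeries c (Cmod w).
Proof.
intros Hc Hw. eapply Rle_trans; [apply Cmod_CSeries_le, ex_CPS; auto|].
right; apply Series_ext; intros n. rewrite Cmod_CPS_term.
apply Rabs_pos_eq, Rmult_le_pos; auto. apply pow_le, Cmod_ge_0.
Qed.

(** Real and imaginary parts split the product into four real Cauchy products of absolutely
    convergent series. *)
Lemma CPS_mult (a b : nat -> R) (w : C) :
  Rbar_lt (Cmod w) (CV_radius a) -> Rbar_lt (Cmod w) (CV_radius b) ->
  CPS (PS_mult a b) w = (CPS a w * CPS b w)%C.
Proof.
intros Ha Hb. apply ex_CPS in Ha. apply ex_CPS in Hb.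
set (u := fun n => (RtoC (a n) * w ^ n)%C) in *. set (v := fun n => (RtoC (b n) * w ^ n)%C) in *.
assert (Hre := ex_series_Re _ Ha). assert (Him := ex_series_Im _ Ha).
assert (Hre' := ex_series_Re _ Hb). assert (Him' := ex_series_Im _ Hb).
assert (Are := ex_series_Re_abs _ Ha). assert (Aim := ex_series_Im_abs _ Ha).
assert (Are' := ex_series_Re_abs _ Hb). assert (Aim' := ex_series_Im_abs _ Hb).
assert (Hm : forall p q : nat -> R, ex_series p -> ex_series q ->
  ex_series (fun n => Rabs (p n)) -> ex_series (fun n => Rabs (q n)) ->
  is_series (fun n => sum_f_R0 (fun k => p k * q (n - k)%nat) n) (Series p * Series q)).
{ intros p q Hp Hq Hp' Hq'; apply is_series_mult; auto; apply Series_correct; auto. }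
assert (Huv : forall n, (RtoC (PS_mult a b n) * w ^ n)%C =
  (sum_f_R0 (fun k => Re (u k) * Re (v (n - k)%nat)) n - sum_f_R0 (fun k => Im (u k) * Im (v (n - k)%nat)) n,
   sum_f_R0 (fun k => Re (u k) * Im (v (n - k)%nat)) n + sum_f_R0 (fun k => Im (u k) * Re (v (n - k)%nat)) n)).
{ intros n. rewrite <- minus_sum, <- plus_sum.
  assert (Hk : forall k, (k <= n)%nat ->
    (Re (u k) * Re (v (n - k)%nat) - Im (u k) * Im (v (n - k)%nat) = a k * b (n - k)%nat * Re (w ^ n)) /\
    (Re (u k) * Im (v (n - k)%nat) + Im (u k) * Re (v (n - k)%nat) = a k * b (n - k)%nat * Im (w ^ n))).
  { intros k Hk. replace (w ^ n)%C with (w ^ k * w ^ (n - k))%C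
      by (rewrite <- Cpow_add_r; f_equal; lia).
    unfold u, v; simpl; split; ring. }
  unfold PS_mult. apply injective_projections; simpl.
  - rewrite (sum_eq (fun k => Re (u k) * Re (v (n - k)%nat) - Im (u k) * Im (v (n - k)%nat))
      (fun k => a k * b (n - k)%nat * Re (w ^ n))) by (intros k Hkn; apply Hk; auto).
    rewrite <- scal_sum. unfold Re; ring.
  - rewrite (sum_eq (fun k => Re (u k) * Im (v (n - k)%nat) + Im (u k) * Re (v (n - k)%nat))
      (fun k => a k * b (n - k)%nat * Im (w ^ n))) by (intros k Hkn; apply Hk; auto).
    rewrite <- scal_sum. unfold Im; ring. }
unfold CPS at 1. rewrite (CSeries_ext _ _ Huv).
apply injective_projections; simpl; apply is_series_unique.
- apply (is_series_minus (V := R_NormedModule)); apply Hm; auto.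
- apply (is_series_plus (V := R_NormedModule)); apply Hm; auto.
Qed.

(** The last factor is the second derivative of the power at [rho], so that summation produces the
    series of second derivatives, which converges inside the disc. For [n < 2] the truncated [pred]
    is harmless, because [INR n] or [INR (pred n)] vanishes. *)
Lemma Cpow_taylor_bound (y z : C) (rho : R) (n : nat) : Cmod y <= rho -> Cmod z <= rho ->
  Cmod (y ^ n - z ^ n - (y - z) * (RtoC (INR n) * z ^ pred n))%C
    <= Cmod (y - z) ^ 2 * (INR n * (INR (pred n) * rho ^ pred (pred n))).
Proof.
intros Hy Hz. assert (Hr : 0 <= rho) by (pose proof (Cmod_ge_0 z); lra).
induction n as [|n IH].
- simpl. replace (1 - 1 - (y - z) * (0 * 1))%C with (RtoC 0) by ring. rewrite Cmod_0. lra.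
- replace (y ^ S n - z ^ S n - (y - z) * (RtoC (INR (S n)) * z ^ pred (S n)))%C
    with (y * (y ^ n - z ^ n - (y - z) * (RtoC (INR n) * z ^ pred n))
          + (y - z) * (y - z) * (RtoC (INR n) * z ^ pred n))%C.
  2:{ destruct n as [|n]; [simpl; ring|].
      change (pred (S (S n))) with (S n). change (pred (S n)) with n.
      rewrite (S_INR (S n)), RtoC_plus, !Cpow_S. ring. }
  eapply Rle_trans; [apply Cmod_triangle|]. rewrite !Cmod_mult, Cmod_R, Cmod_pow.
  rewrite (Rabs_pos_eq (INR n)) by apply pos_INR.
  cbn [pred]. set (D := Cmod (y - z)) in *. assert (HD : 0 <= D) by apply Cmod_ge_0.
  assert (Hn := pos_INR n).
  apply Rle_trans with (rho * (D ^ 2 * (INR n * (INR (pred n) * rho ^ pred (pred n))))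
    + D ^ 2 * (INR n * rho ^ pred n)).
  + apply Rplus_le_compat.
    * apply Rmult_le_compat; auto; apply Cmod_ge_0.
    * replace (D * D) with (D ^ 2) by ring.
      apply Rmult_le_compat_l; [apply pow_le; auto|]. apply Rmult_le_compat_l; auto.
      apply pow_incr; split; auto; apply Cmod_ge_0.
  + destruct n as [|[|n]].
    * simpl; lra.
    * simpl. assert (0 <= D * (D * 1)) by (apply Rmult_le_pos; lra). lra.
    * change (pred (S (S n))) with (S n). change (pred (S n)) with n.
      rewrite !S_INR. rewrite <- (tech_pow_Rmult rho n).
      assert (0 <= D ^ 2 * (INR n + 1 + 1) * (rho * rho ^ n)).
      { rewrite !S_INR in Hn.
        apply Rmult_le_pos; [apply Rmult_le_pos|apply Rmult_le_pos]; try apply pow_le; auto. }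
      lra.
Qed.

Lemma is_Cderive_CPS (c : nat -> R) (z : C) : Rbar_lt (Cmod z) (CV_radius c) ->
  is_Cderive (CPS c) z (CPS (PS_derive c) z).
Proof.
intros Hz.
assert (Hrho : exists rho, Cmod z < rho /\ Rbar_lt rho (CV_radius c)).
{ destruct (CV_radius c) as [r| |]; simpl in Hz.
  - exists ((Cmod z + r) / 2); simpl; lra.
  - exists (Cmod z + 1); simpl; split; auto; lra.
  - destruct Hz. }
destruct Hrho as (rho & Hzr & Hrho).
assert (Hr0 : 0 <= rho) by (pose proof (Cmod_ge_0 z); lra).
set (B := fun n => Rabs (c n) * (INR n * (INR (pred n) * rho ^ pred (pred n)))).
assert (HB0 : forall n, 0 <= B n).
{ intros n; repeat apply Rmult_le_pos; auto using Rabs_pos, pos_INR, pow_le. }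
assert (HB : ex_series B).
{ apply ex_series_incr_1, ex_series_incr_1.
  apply ex_series_ext with (fun n => Rabs (PS_derive (PS_derive c) n * rho ^ n)).
  - intros n; unfold B, PS_derive. cbn [pred].
    rewrite !Rabs_mult, (Rabs_pos_eq (rho ^ n)) by (apply pow_le; auto).
    rewrite (Rabs_pos_eq (INR (S n))), (Rabs_pos_eq (INR (S (S n)))) by apply pos_INR.
    match goal with |- ?l = ?r => change (@eq R l r) end. ring.
  - apply CV_disk_inside; rewrite !CV_radius_derive, Rabs_pos_eq; auto. }
apply is_Cderive_of_quadratic with (Series B) (rho - Cmod z); [lra|].
intros y Hy.
assert (Hyr : Cmod y <= rho) by (pose proof (Cmod_le_minus_plus y z); lra).
assert (Hy' : Rbar_lt (Cmod y) (CV_radius c)) by (eapply Rbar_le_lt_trans; [|apply Hrho]; auto).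
assert (Hdz : ex_Cseries_abs (fun n => RtoC (PS_derive c n) * z ^ n)%C)
  by (apply ex_CPS; rewrite CV_radius_derive; auto).
(* The derivative series before the shift of index, so that it combines termwise with those of
   [CPS c y] and [CPS c z]; its term at 0 vanishes. *)
set (t := fun n => (RtoC (c n) * (RtoC (INR n) * z ^ pred n))%C).
assert (Ht : ex_Cseries_abs t).
{ apply ex_series_incr_1. apply ex_series_ext with (2 := Hdz). intros n; unfold t, PS_derive.
  cbn [pred]. rewrite RtoC_mult. f_equal; ring. }
assert (Ed : CPS (PS_derive c) z = CSeries t).
{ rewrite (CSeries_incr_1 t Ht). unfold t at 1. simpl (INR 0).
  replace (RtoC (c 0%nat) * (0 * z ^ pred 0))%C with (RtoC 0) by ring. rewrite Cplus_0_l.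
  apply CSeries_ext; intros n. unfold t, PS_derive; cbn [pred]. rewrite RtoC_mult; ring. }
set (E := fun n => (RtoC (c n) * (y ^ n - z ^ n - (y - z) * (RtoC (INR n) * z ^ pred n)))%C).
assert (HE : forall n, Cmod (E n) <= Cmod (y - z) ^ 2 * B n).
{ intros n; unfold E, B. rewrite Cmod_mult, Cmod_R.
  rewrite <- Rmult_assoc, (Rmult_comm (Cmod (y - z) ^ 2)), Rmult_assoc.
  apply Rmult_le_compat_l; [apply Rabs_pos|]. apply Cpow_taylor_bound; lra. }
assert (HexE : ex_Cseries_abs E).
{ apply (ex_series_le (K := R_AbsRing) (V := R_CompleteNormedModule) _ (fun n => Cmod (y - z) ^ 2 * B n)).
  - intros n; change (Rabs (Cmod (E n)) <= Cmod (y - z) ^ 2 * B n).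
    rewrite Rabs_pos_eq by apply Cmod_ge_0; auto.
  - apply ex_series_Rmult; auto. }
assert (EE : (CPS c y - CPS c z - (y - z) * CPS (PS_derive c) z)%C = CSeries E).
{ rewrite Ed.
  assert (E1 := ex_CPS c y Hy'). assert (E2 := ex_CPS c z Hz).
  transitivity (CPS c y + (RtoC (-1) * CPS c z + - (y - z) * CSeries t))%C.
  { rewrite RtoC_m1. ring. }
  unfold CPS. rewrite <- !CSeries_scal by auto.
  rewrite <- CSeries_plus by auto using ex_Cseries_abs_scal.
  rewrite <- CSeries_plus by auto using ex_Cseries_abs_plus, ex_Cseries_abs_scal.
  apply CSeries_ext; intros n; unfold E, t.
  rewrite RtoC_m1. ring. }
rewrite EE. eapply Rle_trans; [apply Cmod_CSeries_le; auto|].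
rewrite Rmult_comm, <- Series_scal_l.
apply Series_le; [|apply ex_series_Rmult; auto].
intros n; split; [apply Cmod_ge_0|auto].
Qed.

(** * The derivatives of f_nu *)

Lemma is_Cderive_unique (f : C -> C) (z l : C) : is_Cderive f z l -> C_derive f z = l.
Proof. apply is_C_derive_unique. Qed.

Lemma is_Cderive_CPS_sqr (c : nat -> R) (z : C) : Rbar_lt (Cmod (z * z)) (CV_radius c) ->
  is_Cderive (fun z => CPS c (z * z)%C) z (RtoC 2 * z * CPS (PS_derive c) (z * z))%C.
Proof.
intros H.
replace (RtoC 2 * z * CPS (PS_derive c) (z * z))%C
  with ((RtoC 1 * z + z * RtoC 1) * CPS (PS_derive c) (z * z))%C.
- apply (is_Cderive_comp (CPS c) (fun z => z * z)%C); [apply is_Cderive_CPS; auto|].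
  apply is_Cderive_mult; apply is_Cderive_id.
- replace (RtoC 2) with (RtoC 1 + RtoC 1)%C by (rewrite <- RtoC_plus; f_equal; ring). ring.
Qed.

Lemma Cmod_sqr_lt (z : C) (j : R) : Cmod z < j -> Cmod (z * z) < j * j.
Proof. intros H; rewrite Cmod_mult. pose proof (Cmod_ge_0 z). nra. Qed.

Lemma BesselJ_entire_eq (nu : R) (z : C) : 0 < nu -> BesselJ_entire nu z = CPS (hcoef nu) (z * z)%C.
Proof.
intros Hnu; unfold BesselJ_entire, CPS. apply CSeries_ext; intros n.
rewrite hcoef_Gamma, RtoC_mult, RtoC_pow, Cpow_mult_r by auto.
assert (E : (z * z)%C = (RtoC 4 * (z / RtoC 2) ^ 2)%C).
{ replace (RtoC 4) with (RtoC 2 * RtoC 2)%C by (rewrite <- RtoC_mult; f_equal; ring).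
  simpl. field. }
rewrite E, Cpow_mult_l. ring.
Qed.

Lemma Rbar_lt_Cmod_hcoef (nu : R) (w : C) : 0 < nu -> Rbar_lt (Cmod w) (CV_radius (hcoef nu)).
Proof. intros Hnu; rewrite CV_radius_hcoef; simpl; auto. Qed.

Lemma is_Cderive_BesselJ_entire (nu : R) (z : C) : 0 < nu ->
  is_Cderive (BesselJ_entire nu) z (RtoC 2 * z * CPS (PS_derive (hcoef nu)) (z * z))%C.
Proof.
intros Hnu. apply is_Cderive_ext with (fun z => CPS (hcoef nu) (z * z)%C) (Cmod z + 1); [lra| |].
- intros; symmetry; apply BesselJ_entire_eq; auto.
- apply is_Cderive_CPS_sqr, Rbar_lt_Cmod_hcoef; auto.
Qed.

(* Taylor coefficients of log h in the variable w. *)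
Definition lcoef (nu : R) (n : nat) : R :=
  match n with O => 0 | S k => - pcoef nu k / INR (S k) end.

Lemma PS_derive_lcoef (nu : R) (n : nat) : PS_derive (lcoef nu) n = PS_opp (pcoef nu) n.
Proof.
unfold PS_derive, lcoef, PS_opp, opp. cbn -[INR].
pose proof (lt_0_INR (S n) ltac:(lia)). field; lra.
Qed.

Lemma CV_radius_lcoef (nu : R) : CV_radius (lcoef nu) = CV_radius (pcoef nu).
Proof.
rewrite <- CV_radius_derive, <- (CV_radius_opp (pcoef nu)).
apply CV_radius_ext, PS_derive_lcoef.
Qed.

Definition log_h (nu : R) (z : C) : C := CPS (lcoef nu) (z * z)%C.

Lemma Rbar_lt_Cmod_pcoef (nu j : R) (z : C) : 0 < nu -> h_pos_below nu (j * j) -> Cmod z < j ->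
  Rbar_lt (Cmod (z * z)) (CV_radius (pcoef nu)).
Proof.
intros Hnu HX Hz. rewrite <- (Rabs_pos_eq (Cmod (z * z))) by apply Cmod_ge_0.
apply CV_radius_pcoef with (j * j); auto.
rewrite Rabs_pos_eq by apply Cmod_ge_0. apply Cmod_sqr_lt; auto.
Qed.

Lemma CPS_opp (c : nat -> R) (w : C) : Rbar_lt (Cmod w) (CV_radius c) ->
  CPS (PS_opp c) w = (- CPS c w)%C.
Proof.
intros H. rewrite (CPS_ext _ (PS_scal (-1) c)).
- rewrite CPS_scal by auto. rewrite RtoC_m1. ring.
- intros n; unfold PS_opp, PS_scal, opp, scal; simpl; unfold mult; simpl; ring.
Qed.

Lemma is_Cderive_log_h (nu j : R) (z : C) : 0 < nu -> h_pos_below nu (j * j) -> Cmod z < j ->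
  is_Cderive (log_h nu) z (- (RtoC 2 * z * CPS (pcoef nu) (z * z)))%C.
Proof.
intros Hnu HX Hz. assert (H := Rbar_lt_Cmod_pcoef nu j z Hnu HX Hz).
replace (- (RtoC 2 * z * CPS (pcoef nu) (z * z)))%C
  with (RtoC 2 * z * CPS (PS_derive (lcoef nu)) (z * z))%C.
- apply is_Cderive_CPS_sqr. rewrite CV_radius_lcoef; auto.
- rewrite (CPS_ext _ _ _ (PS_derive_lcoef nu)), CPS_opp by auto. ring.
Qed.

Lemma CPS_pcoef_mult_h (nu j : R) (z : C) : 0 < nu -> h_pos_below nu (j * j) -> Cmod z < j ->
  (CPS (PS_derive (hcoef nu)) (z * z) = - (CPS (pcoef nu) (z * z) * CPS (hcoef nu) (z * z)))%C.
Proof.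
intros Hnu HX Hz. assert (H := Rbar_lt_Cmod_pcoef nu j z Hnu HX Hz).
rewrite <- CPS_mult by auto using Rbar_lt_Cmod_hcoef.
rewrite (CPS_ext _ _ _ (fun n => pcoef_mult_hcoef nu n Hnu)).
change (fun n => - PS_derive (hcoef nu) n) with (PS_opp (PS_derive (hcoef nu))).
rewrite CPS_opp; [ring|]. rewrite CV_radius_derive. apply Rbar_lt_Cmod_hcoef; auto.
Qed.

Lemma Cmod_ray_lt (z : C) (t j : R) : 0 <= t <= 1 -> Cmod z < j -> Cmod (RtoC t * z) < j.
Proof.
intros Ht Hz. rewrite Cmod_mult, Cmod_R, Rabs_pos_eq by lra.
pose proof (Cmod_ge_0 z). nra.
Qed.

(* [exp (- log h) * h] has derivative 0 along rays. *)
Lemma BesselJ_entire_neq_0 (nu j : R) (z : C) : 0 < nu -> h_pos_below nu (j * j) -> Cmod z < j ->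
  BesselJ_entire nu z <> RtoC 0.
Proof.
intros Hnu HX Hz.
set (F := fun u => (Cexp (- log_h nu u) * BesselJ_entire nu u)%C).
assert (HF : forall u, Cmod u < j -> is_Cderive F u (RtoC 0)).
{ intros u Hu. assert (HL := is_Cderive_log_h nu j u Hnu HX Hu).
  assert (HB := is_Cderive_BesselJ_entire nu u Hnu).
  assert (HN : is_Cderive (fun u => - log_h nu u)%C u (RtoC 2 * u * CPS (pcoef nu) (u * u))%C).
  { apply is_Cderive_ext with (fun u => RtoC (-1) * log_h nu u)%C (Cmod u + 1); [lra| |].
    - intros; rewrite RtoC_m1; ring.
    - replace (RtoC 2 * u * CPS (pcoef nu) (u * u))%C
        with (RtoC 0 * log_h nu u + RtoC (-1) * (- (RtoC 2 * u * CPS (pcoef nu) (u * u))))%C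
        by (rewrite RtoC_m1; ring).
      apply is_Cderive_mult; auto. apply is_Cderive_const. }
  assert (HE := is_Cderive_comp Cexp (fun u => - log_h nu u)%C u _ _ (is_Cderive_Cexp _) HN).
  assert (HM := is_Cderive_mult _ _ _ _ _ HE HB).
  rewrite BesselJ_entire_eq, (CPS_pcoef_mult_h nu j u) in HM by auto.
  match type of HM with is_Cderive _ _ ?l => replace (RtoC 0) with l; [exact HM|ring] end. }
assert (E : F (RtoC 0 * z)%C = F (RtoC 1 * z)%C).
{ apply (eq_is_derive (V := C_R_NormedModule) (fun t => F (RtoC t * z)%C) 0 1); [|lra].
  intros t Ht. replace (@zero C_R_NormedModule) with (z * RtoC 0)%C.
  - apply is_Cderive_ray, HF, Cmod_ray_lt; auto.
  - rewrite Cmult_0_r. reflexivity. }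
rewrite Cmult_0_l, Cmult_1_l in E. unfold F in E.
intros H0. rewrite H0, Cmult_0_r, BesselJ_entire_eq in E by auto.
rewrite Cmult_0_l, CPS_0 in E. simpl in E. rewrite Cmult_1_r in E.
exact (Cexp_neq_0 _ E).
Qed.

(** The absence of zeros on the disc allows [h] to be cancelled in the integrand, which then is the
    derivative of [log_h] along the ray; [log_h] vanishes at 0. *)
Lemma log_branch_eq (nu j : R) (z : C) : 0 < nu -> h_pos_below nu (j * j) -> Cmod z < j ->
  log_branch (BesselJ_entire nu) z = log_h nu z.
Proof.
intros Hnu HX Hz.
set (dL := fun u : C => (- (RtoC 2 * u * CPS (pcoef nu) (u * u)))%C).
assert (HI : is_RInt (V := C_R_CompleteNormedModule) (fun t => (z * dL (RtoC t * z))%C) 0 1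
  (minus (log_h nu (RtoC 1 * z)%C : C_R_CompleteNormedModule) (log_h nu (RtoC 0 * z)%C))).
{ apply (is_RInt_derive (V := C_R_CompleteNormedModule) (fun t => log_h nu (RtoC t * z)%C));
    rewrite Rmin_left, Rmax_right by lra; intros t Ht.
  - apply is_Cderive_ray, (is_Cderive_log_h nu j); auto. apply Cmod_ray_lt; auto.
  - apply (ex_derive_continuous (K := R_AbsRing) (V := C_R_NormedModule)).
    assert (Hu : Cmod (RtoC t * z) < j) by (apply Cmod_ray_lt; auto).
    eexists. apply (is_Cderive_ray (fun u => z * dL u)%C z).
    apply is_Cderive_mult; [apply is_Cderive_const|].
    apply is_Cderive_ext with (fun u => - RtoC 2 * (u * CPS (pcoef nu) (u * u)))%C j; auto.
    + intros; unfold dL; ring.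
    + apply is_Cderive_mult; [apply is_Cderive_const|].
      apply is_Cderive_mult; [apply is_Cderive_id|].
      apply is_Cderive_CPS_sqr, (Rbar_lt_Cmod_pcoef nu j); auto. }
apply is_RInt_unique in HI.
unfold log_branch. rewrite <- (RInt_ext (V := C_R_CompleteNormedModule) (fun t => (z * dL (RtoC t * z))%C)).
- rewrite HI. rewrite Cmult_1_l, Cmult_0_l.
  transitivity (log_h nu z - log_h nu (RtoC 0))%C; [reflexivity|].
  unfold log_h at 2. rewrite Cmult_0_l, CPS_0. simpl. ring.
- rewrite Rmin_left, Rmax_right by lra; intros t Ht.
  assert (Hu : Cmod (RtoC t * z) < j) by (apply Cmod_ray_lt; auto; lra).
  assert (H0 := BesselJ_entire_neq_0 nu j _ Hnu HX Hu).
  rewrite (is_Cderive_unique _ _ _ (is_Cderive_BesselJ_entire nu _ Hnu)).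
  rewrite (CPS_pcoef_mult_h nu j) by auto. rewrite BesselJ_entire_eq in * by auto.
  unfold dL. match goal with |- ?l = ?r => change (@eq C l r) end. field; auto.
Qed.

(** * The function as [z] times an exponential, and its derivatives *)

Definition f_exp (nu : R) (z : C) : C := Cexp (RtoC (1 / nu) * log_h nu z).
Definition Pz (nu : R) (z : C) : C := CPS (bcoef nu) (z * z)%C.
Definition dPz (nu : R) (z : C) : C := (RtoC 2 * z * CPS (PS_derive (bcoef nu)) (z * z))%C.

Lemma f_nu_eq (nu j : R) (z : C) : 0 < nu -> h_pos_below nu (j * j) -> Cmod z < j ->
  f_nu nu z = (z * f_exp nu z)%C.
Proof.
intros. unfold f_nu, power_branch. rewrite (log_branch_eq nu j) by auto. reflexivity.
Qed.

Lemma Rbar_lt_Cmod_bcoef (nu j : R) (z : C) : 0 < nu -> h_pos_below nu (j * j) -> Cmod z < j ->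
  Rbar_lt (Cmod (z * z)) (CV_radius (bcoef nu)).
Proof. intros; rewrite CV_radius_bcoef by auto; apply Rbar_lt_Cmod_pcoef with j; auto. Qed.

Lemma is_Cderive_Pz (nu j : R) (z : C) : 0 < nu -> h_pos_below nu (j * j) -> Cmod z < j ->
  is_Cderive (Pz nu) z (dPz nu z).
Proof. intros; apply is_Cderive_CPS_sqr, Rbar_lt_Cmod_bcoef with j; auto. Qed.

Lemma is_Cderive_one_minus_Pz (nu j : R) (z : C) : 0 < nu -> h_pos_below nu (j * j) -> Cmod z < j ->
  is_Cderive (fun z => RtoC 1 - Pz nu z)%C z (- dPz nu z)%C.
Proof.
intros Hnu HX Hz.
apply is_Cderive_ext with (fun u => RtoC 1 + RtoC (-1) * Pz nu u)%C j; auto.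
- intros; rewrite RtoC_m1; ring.
- replace (- dPz nu z)%C with (RtoC 0 + (RtoC 0 * Pz nu z + RtoC (-1) * dPz nu z))%C
    by (rewrite RtoC_m1; ring).
  apply is_Cderive_plus; [apply is_Cderive_const|].
  apply is_Cderive_mult; [apply is_Cderive_const|apply is_Cderive_Pz with j; auto].
Qed.

Lemma is_Cderive_dPz (nu j : R) (z : C) : 0 < nu -> h_pos_below nu (j * j) -> Cmod z < j ->
  exists l, is_Cderive (dPz nu) z l.
Proof.
intros Hnu HX Hz; eexists. unfold dPz.
apply is_Cderive_mult; [apply is_Cderive_mult; [apply is_Cderive_const|apply is_Cderive_id]|].
apply is_Cderive_CPS_sqr; rewrite CV_radius_derive; apply Rbar_lt_Cmod_bcoef with j; auto.
Qed.

(** Only [z * dE] is specified: a formula for [dE] through [Pz] would divide by [z], and the origin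
    belongs to the disc. *)
Lemma is_Cderive_f_exp (nu j : R) (z : C) : 0 < nu -> h_pos_below nu (j * j) -> Cmod z < j ->
  exists dE, is_Cderive (f_exp nu) z dE /\ (z * dE = - (f_exp nu z * Pz nu z))%C.
Proof.
intros Hnu HX Hz.
assert (HL := is_Cderive_log_h nu j z Hnu HX Hz).
assert (Hs := is_Cderive_mult (fun _ => RtoC (1 / nu)) (log_h nu) z _ _ (is_Cderive_const _ z) HL).
assert (HE := is_Cderive_comp Cexp _ z _ _ (is_Cderive_Cexp _) Hs).
eexists; split; [exact HE|].
unfold Pz, bcoef. assert (Hp := Rbar_lt_Cmod_pcoef nu j z Hnu HX Hz).
rewrite CPS_scal, CPS_incr_1 by (rewrite ?CV_radius_incr_1; auto).
unfold f_exp. unfold Rdiv. rewrite !RtoC_mult. ring.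
Qed.

Lemma is_Cderive_f_nu (nu j : R) (z : C) : 0 < nu -> h_pos_below nu (j * j) -> Cmod z < j ->
  is_Cderive (f_nu nu) z (f_exp nu z * (RtoC 1 - Pz nu z))%C.
Proof.
intros Hnu HX Hz. destruct (is_Cderive_f_exp nu j z Hnu HX Hz) as (dE & HE & Hz').
apply is_Cderive_ext with (fun u => u * f_exp nu u)%C j; auto.
- intros; symmetry; apply f_nu_eq with j; auto.
- replace (f_exp nu z * (RtoC 1 - Pz nu z))%C with (RtoC 1 * f_exp nu z + z * dE)%C
    by (rewrite Hz'; ring).
  apply is_Cderive_mult; auto. apply is_Cderive_id.
Qed.

Lemma is_Cderive_df_nu (nu j : R) (z : C) : 0 < nu -> h_pos_below nu (j * j) -> Cmod z < j ->
  exists l, is_Cderive (C_derive (f_nu nu)) z l /\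
    (z * l = - (f_exp nu z * Pz nu z * (RtoC 1 - Pz nu z)) - f_exp nu z * (z * dPz nu z))%C.
Proof.
intros Hnu HX Hz. destruct (is_Cderive_f_exp nu j z Hnu HX Hz) as (dE & HE & Hz').
exists (dE * (RtoC 1 - Pz nu z) + f_exp nu z * - dPz nu z)%C; split.
- apply is_Cderive_ext with (fun u => f_exp nu u * (RtoC 1 - Pz nu u))%C j; auto.
  + intros; symmetry; apply is_Cderive_unique, is_Cderive_f_nu with j; auto.
  + apply (is_Cderive_mult (f_exp nu) (fun u => RtoC 1 - Pz nu u)%C); auto.
    apply is_Cderive_one_minus_Pz with j; auto.
- rewrite Cmult_plus_distr_l, !Cmult_assoc, Hz'. ring.
Qed.

Lemma convexity_quotient_f_nu (nu j : R) (z : C) : 0 < nu -> h_pos_below nu (j * j) -> Cmod z < j ->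
  (RtoC 1 - Pz nu z)%C <> RtoC 0 ->
  convexity_quotient (f_nu nu) z = (RtoC 1 - Pz nu z - z * dPz nu z / (RtoC 1 - Pz nu z))%C.
Proof.
intros Hnu HX Hz H1. destruct (is_Cderive_df_nu nu j z Hnu HX Hz) as (l & Hl & Hzl).
unfold convexity_quotient. rewrite (is_Cderive_unique _ _ _ Hl), Hzl.
rewrite (is_Cderive_unique _ _ _ (is_Cderive_f_nu nu j z Hnu HX Hz)).
assert (HE : f_exp nu z <> RtoC 0) by apply Cexp_neq_0.
field; auto.
Qed.

(** * The radius of convexity *)

Lemma PSeries_bcoef_lt_1 (nu X w : R) : 0 < nu -> h_pos_below nu X -> 0 <= w < X ->
  0 < Gfun nu w -> PSeries (bcoef nu) w < 1.
Proof.
intros Hnu HX Hw HG. rewrite Gfun_eq with (X := X) in HG by (auto; rewrite Rabs_pos_eq; lra).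
specialize (HX w Hw). nra.
Qed.

Lemma Kfun_neg_iff (nu alpha w : R) : PSeries (bcoef nu) w < 1 ->
  (Kfun nu alpha w < 0 <-> alpha < 1 - PSeries (bcoef nu) w
    - 2 * w * PSeries (PS_derive (bcoef nu)) w / (1 - PSeries (bcoef nu) w)).
Proof.
intros H. unfold Kfun. set (P := PSeries (bcoef nu) w) in *.
set (T := 2 * w * PSeries (PS_derive (bcoef nu)) w).
replace (1 - P - T / (1 - P)) with (alpha - (T - (1 - P) * (1 - P - alpha)) / (1 - P)) by (field; lra).
set (K := T - (1 - P) * (1 - P - alpha)).
assert (HK : K = K / (1 - P) * (1 - P)) by (field; lra).
split; intros; nra.
Qed.

Lemma Kfun_zero_iff (nu alpha w : R) : PSeries (bcoef nu) w < 1 ->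
  (Kfun nu alpha w = 0 <-> 1 - PSeries (bcoef nu) w
    - 2 * w * PSeries (PS_derive (bcoef nu)) w / (1 - PSeries (bcoef nu) w) = alpha).
Proof.
intros H. unfold Kfun. set (P := PSeries (bcoef nu) w) in *.
set (T := 2 * w * PSeries (PS_derive (bcoef nu)) w).
replace (1 - P - T / (1 - P)) with (alpha - (T - (1 - P) * (1 - P - alpha)) / (1 - P)) by (field; lra).
set (K := T - (1 - P) * (1 - P - alpha)).
assert (HK : K = K / (1 - P) * (1 - P)) by (field; lra).
split; intros; nra.
Qed.

Lemma Cmod_one_minus_Pz (nu j : R) (z : C) : 0 < nu -> h_pos_below nu (j * j) -> Cmod z < j ->
  Cmod (Pz nu z) <= PSeries (bcoef nu) (Cmod (z * z)) /\
  1 - PSeries (bcoef nu) (Cmod (z * z)) <= Cmod (RtoC 1 - Pz nu z).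
Proof.
intros Hnu HX Hz.
assert (HP : Cmod (Pz nu z) <= PSeries (bcoef nu) (Cmod (z * z))).
{ apply Cmod_CPS_le; [intros; apply bcoef_nonneg; auto|apply Rbar_lt_Cmod_bcoef with j; auto]. }
split; auto.
pose proof (Cmod_le_minus_plus (RtoC 1) (Pz nu z)) as H. rewrite Cmod_1 in H. lra.
Qed.

(* The power series of [P] has nonnegative coefficients, so the real part is
   smallest on the positive axis. *)
Lemma Re_convexity_quotient_ge (nu j : R) (z : C) : 0 < nu -> h_pos_below nu (j * j) ->
  Cmod z < j -> PSeries (bcoef nu) (Cmod (z * z)) < 1 ->
  1 - PSeries (bcoef nu) (Cmod (z * z))
    - 2 * Cmod (z * z) * PSeries (PS_derive (bcoef nu)) (Cmod (z * z))
      / (1 - PSeries (bcoef nu) (Cmod (z * z)))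
  <= Re (RtoC 1 - Pz nu z - z * dPz nu z / (RtoC 1 - Pz nu z))%C.
Proof.
intros Hnu HX Hz HP1.
destruct (Cmod_one_minus_Pz nu j z Hnu HX Hz) as [HP H1].
set (s := Cmod (z * z)) in *. set (P := PSeries (bcoef nu) s) in *.
set (D := PSeries (PS_derive (bcoef nu)) s).
assert (HD : Cmod (CPS (PS_derive (bcoef nu)) (z * z)) <= D).
{ apply Cmod_CPS_le.
  - intros n; apply Rmult_le_pos; [apply pos_INR|apply bcoef_nonneg; auto].
  - rewrite CV_radius_derive; apply Rbar_lt_Cmod_bcoef with j; auto. }
assert (Hne : (RtoC 1 - Pz nu z)%C <> RtoC 0) by (apply Cmod_gt_0; lra).
set (T := (z * dPz nu z / (RtoC 1 - Pz nu z))%C).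
assert (HT : Cmod T <= 2 * s * D / (1 - P)).
{ unfold T. rewrite Cmod_div by auto. unfold dPz.
  replace (z * (RtoC 2 * z * CPS (PS_derive (bcoef nu)) (z * z)))%C
    with (RtoC 2 * (z * z) * CPS (PS_derive (bcoef nu)) (z * z))%C by ring.
  rewrite (Cmod_mult (RtoC 2 * (z * z))), (Cmod_mult (RtoC 2)), Cmod_R, (Rabs_pos_eq 2) by lra.
  fold s. assert (0 <= s) by apply Cmod_ge_0.
  pose proof (Cmod_ge_0 (CPS (PS_derive (bcoef nu)) (z * z))).
  apply Rmult_le_compat; try nra.
  - left; apply Rinv_0_lt_compat; lra.
  - apply Rinv_le_contravar; lra. }
change (1 - P - 2 * s * D / (1 - P) <= 1 - Re (Pz nu z) - Re T).
pose proof (Rle_trans _ _ _ (Rle_abs _) (re_le_Cmod (Pz nu z))).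
pose proof (Rle_trans _ _ _ (Rle_abs _) (re_le_Cmod T)). lra.
Qed.

Lemma convex_of_order_below (nu alpha j rho : R) : 0 < nu -> h_pos_below nu (j * j) -> rho < j ->
  (forall w, 0 <= w < rho * rho -> 0 < Gfun nu w) ->
  (forall w, 0 <= w < rho * rho -> Kfun nu alpha w < 0) ->
  convex_of_order_on_disc alpha (f_nu nu) rho.
Proof.
intros Hnu HX Hrj HG HK.
assert (HP : forall z, Cmod z < rho -> PSeries (bcoef nu) (Cmod (z * z)) < 1).
{ intros z Hz. pose proof (Cmod_sqr_lt z rho Hz). pose proof (Cmod_ge_0 (z * z)).
  pose proof (Cmod_sqr_lt z j ltac:(lra)).
  apply PSeries_bcoef_lt_1 with (j * j); auto. }
assert (Hne : forall z, Cmod z < rho -> (RtoC 1 - Pz nu z)%C <> RtoC 0).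
{ intros z Hz. apply Cmod_gt_0. specialize (HP z Hz).
  destruct (Cmod_one_minus_Pz nu j z Hnu HX) as [_ H]; lra. }
assert (Hq : forall z, Cmod z < rho -> convexity_quotient (f_nu nu) z
  = (RtoC 1 - Pz nu z - z * dPz nu z / (RtoC 1 - Pz nu z))%C).
{ intros z Hz. apply convexity_quotient_f_nu with j; auto; lra. }
repeat split.
- intros z Hz. eexists. apply is_Cderive_f_nu with j; auto; lra.
- intros z Hz. destruct (is_Cderive_df_nu nu j z) as (l & Hl & _); auto; [lra|]. exists l; exact Hl.
- intros z Hz. rewrite (is_Cderive_unique _ _ _ (is_Cderive_f_nu nu j z Hnu HX ltac:(lra))).
  apply Cmult_neq_0; auto. apply Cexp_neq_0.
- intros z Hz. assert (Hzj : Cmod z < j) by lra.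
  assert (H1 := is_Cderive_one_minus_Pz nu j z Hnu HX Hzj).
  destruct (is_Cderive_dPz nu j z Hnu HX Hzj) as [l2 H2].
  assert (H3 := is_Cderive_comp Cinv (fun z => RtoC 1 - Pz nu z)%C z _ _ (is_Cderive_inv _ (Hne z Hz)) H1).
  eexists. apply is_Cderive_ext with (fun z => (RtoC 1 - Pz nu z) +
    RtoC (-1) * (z * (dPz nu z * / (RtoC 1 - Pz nu z))))%C rho; auto.
  + intros y Hy. rewrite (Hq y Hy), RtoC_m1. unfold Cdiv. ring.
  + apply (is_Cderive_plus (fun z => RtoC 1 - Pz nu z)%C); [exact H1|].
    apply is_Cderive_mult; [apply is_Cderive_const|].
    apply is_Cderive_mult; [apply is_Cderive_id|].
    apply (is_Cderive_mult (dPz nu)); [exact H2|exact H3].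
- intros z Hz. rewrite Hq by auto.
  eapply Rlt_le_trans; [|apply (Re_convexity_quotient_ge nu j); auto; lra].
  apply Kfun_neg_iff; auto. apply HK; split; [apply Cmod_ge_0|apply Cmod_sqr_lt; auto].
Qed.

(** Here the bound of [Re_convexity_quotient_ge] is attained, which is why the radius cannot be
    larger. *)
Lemma convexity_quotient_RtoC (nu j x : R) : 0 < nu -> h_pos_below nu (j * j) ->
  0 <= x < j -> PSeries (bcoef nu) (x * x) < 1 ->
  convexity_quotient (f_nu nu) (RtoC x) = RtoC (1 - PSeries (bcoef nu) (x * x)
    - 2 * (x * x) * PSeries (PS_derive (bcoef nu)) (x * x) / (1 - PSeries (bcoef nu) (x * x))).
Proof.
intros Hnu HX Hx HP.
assert (HPz : (RtoC 1 - Pz nu (RtoC x))%C = RtoC (1 - PSeries (bcoef nu) (x * x))).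
{ unfold Pz. rewrite <- RtoC_mult, CPS_RtoC, <- RtoC_minus. reflexivity. }
assert (Hn0 : RtoC (1 - PSeries (bcoef nu) (x * x)) <> RtoC 0).
{ intros H; apply RtoC_inj in H; lra. }
rewrite (convexity_quotient_f_nu nu j), HPz; auto.
- unfold dPz. rewrite <- (RtoC_mult x x), CPS_RtoC, <- !RtoC_mult.
  rewrite <- RtoC_div, <- RtoC_minus by lra. f_equal. f_equal. f_equal. ring.
- rewrite Cmod_R, Rabs_pos_eq; lra.
- rewrite HPz; auto.
Qed.

Theorem theorem1 (nu alpha : R) (Hnu : 0 < nu) (Halpha : 0 <= alpha < 1) :
  exists r j' j : R,
    smallest_positive (fun x => BesselJ nu x = 0) j /\
    smallest_positive (fun x => Derive (BesselJ nu) x = 0) j' /\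
    smallest_positive (convexity_equation nu alpha) r /\
    radius_of_convexity alpha (f_nu nu) = Finite r /\
    r < j' < j.
Proof.
destruct (h_first_zero nu Hnu) as (X & HX0 & HhX & HX).
destruct (Gfun_first_zero nu X Hnu HX0 HhX HX) as (Y & HY & HGY & HG).
destruct (Kfun_first_zero nu alpha X Y Hnu (proj2 Halpha) HX HY HGY) as (W & HW & HKW & HK).
destruct (BesselJ_eq nu Hnu) as (c & Hc & HJ).
assert (HdJ := BesselJ_derive_eq nu c Hnu HJ).
(* The three points were found in the variable [w = x ^ 2]; square roots carry them back to [x],
   preserving their order. *)
assert (Hsq : forall w, 0 < w -> exists x, 0 < x /\ x * x = w).
{ intros w Hw; exists (sqrt w); split; [apply sqrt_lt_R0; auto|apply sqrt_sqrt; lra]. }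
destruct (Hsq X) as (j & Hj & EX); [lra|].
destruct (Hsq Y) as (j' & Hj' & EY); [lra|].
destruct (Hsq W) as (r & Hr & EW); [lra|].
subst X Y W. clear Hsq.
assert (Hjj' : j' < j) by nra. assert (Hrj' : r < j') by nra.
assert (E2 : forall x, x ^ 2 = x * x) by (intros; ring).
assert (HP : forall w, 0 <= w <= r * r -> PSeries (bcoef nu) w < 1).
{ intros w Hw. apply PSeries_bcoef_lt_1 with (j * j); auto; [lra|apply HG; lra]. }
exists r, j', j. split; [|split; [|split; [|split]]].
- split; [auto|split].
  + rewrite HJ, E2, HhX by auto. ring.
  + intros y Hy Hy0. apply Rnot_lt_le; intros Hlt.
    rewrite HJ, E2 in Hy0 by auto.
    assert (0 < PSeries (hcoef nu) (y * y)) by (apply HX; nra).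
    assert (0 < c * (Rpower y nu * PSeries (hcoef nu) (y * y))); [|lra].
    repeat apply Rmult_lt_0_compat; auto. apply exp_pos.
- split; [auto|split].
  + rewrite HdJ, E2, HGY by auto. ring.
  + intros y Hy Hy0. apply Rnot_lt_le; intros Hlt.
    rewrite HdJ, E2 in Hy0 by auto.
    assert (0 < Gfun nu (y * y)) by (apply HG; nra).
    assert (0 < c * (Rpower y (nu - 1) * (nu * Gfun nu (y * y)))); [|lra].
    repeat apply Rmult_lt_0_compat; auto. apply exp_pos.
- split; [auto|split].
  + destruct (convexity_lhs_eq nu (j * j) r) as (H1 & H2 & H3); auto; try (rewrite E2; nra).
    { rewrite E2; apply HG; nra. }
    split; [exact H1|split; [exact H2|]]. rewrite H3, E2.
    apply Kfun_zero_iff; auto. apply HP; nra.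
  + intros y Hy (_ & _ & H3). apply Rnot_lt_le; intros Hlt.
    destruct (convexity_lhs_eq nu (j * j) y) as (_ & _ & H3'); auto; try (rewrite E2; nra).
    { rewrite E2; apply HG; nra. }
    rewrite H3', E2 in H3. apply Kfun_zero_iff in H3; [|apply HP; nra].
    specialize (HK (y * y)). nra.
- unfold radius_of_convexity. apply is_lub_Rbar_unique; split.
  (* A disc of radius [s > r] contains the point [r], where the quotient equals [alpha], against the
     strict inequality. *)
  + intros s (Hs & _ & _ & _ & _ & Hs'). simpl. apply Rnot_lt_le; intros Hlt.
    specialize (Hs' (RtoC r)). rewrite Cmod_R, Rabs_pos_eq in Hs' by lra.
    rewrite (convexity_quotient_RtoC nu j) in Hs' by (auto; try lra; apply HP; nra).
    apply Kfun_zero_iff in HKW; [|apply HP; nra].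
    simpl in Hs'. rewrite HKW in Hs'. specialize (Hs' Hlt). lra.
  (* The disc is open, so [r] itself belongs to the set of admissible radii. *)
  + intros b Hb. apply Hb. split; auto.
    apply convex_of_order_below with j; auto; [lra|].
    intros w Hw; apply HG; lra.
- lra.
Qed.
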